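(* Let $(\mathcal C,P,\Theta)$ be a small category with duality, $T:\mathcal C\to\mathcal C$ an endofunctor and $\lambda:P\Rightarrow TPT^{op}$ a natural transformation with $TP(\lambda_x)\circ\lambda_{PT(x)}\circ\Theta_{T(x)}=T(\Theta_x)$ for all $x$. Then the morphism $F_\bullet:\mathcal NU^T_\bullet(\mathcal C)\to\mathcal NC^T_\bullet(\mathcal C)$ is a unital relative $2$-Segal simplicial groupoid.
   Context: Segal notions for simplicial groupoids: $X_I:=X_k$ for ordered $I$ with $|I|=k+1$; $\times^R$ is $2$-pullback; weak equivalence = equivalence of groupoids. $Y_\bullet$ is $1$-Segal if for $n\ge2$, $Y_n\to Y_1\times^R_{Y_0}\cdots\times^R_{Y_0}Y_1$ is an equivalence; $X_\bullet$ is $2$-Segal if for $n\ge3$, $0\le i<j\le n$, $X_n\to X_{\{i,\dots,j\}}\times^R_{X_{\{i,j\}}}X_{\{0,\dots,i,j,\dots,n\}}$ is an equivalence. For $X_\bullet$ $2$-Segal, $F_\bullet:Y_\bullet\to X_\bullet$ is relative $2$-Segal if $Y_\bullet$ is $1$-Segal and for $n\ge2$, $0\le i<j\le n$, $Y_n\to X_{\{i,\dots,j\}}\times^R_{X_{\{i,j\}}}Y_{\{0,\dots,i,j,\dots,n\}}$ (components $Y_n\to Y_{\{i,\dots,j\}}\xrightarrow{F}X_{\{i,\dots,j\}}$ and restriction) is an equivalence; unital if also for $n\ge2$, $0\le i\le n-1$, $(F_{\{i\}}\circ\partial_{\{i\}})\times s_i:Y_{n-1}\to X_{\{i\}}\times^R_{X_{\{i,i+1\}}}Y_n$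 is an equivalence. Category with duality $(\mathcal C,P,\Theta)$: $P:\mathcal C^{op}\to\mathcal C$, $\Theta:\mathbf 1\Rightarrow PP^{op}$ iso with $P(\Theta_U)\Theta_{P(U)}=\mathbf 1$. Symmetric form: $(N,\psi)$ with $\psi:N\to P(N)$ iso and $P(\psi)\Theta_N=\psi$; isometry $\phi:(M,\psi_M)\to(N,\psi_N)$: iso with $P(\phi)\psi_N\phi=\psi_M$; the Hermitian groupoid $\mathcal D_h$ of a category with duality $\mathcal D$ consists of symmetric forms and isometries. $\mathcal NC^T_n(\mathcal C)$ is the groupoid of diagrams $x_0\xrightarrow{f_0}\cdots\xrightarrow{f_{n-1}}x_n\xrightarrow{f_n}T(x_0)$ with isomorphisms $x_i\to y_i$ as morphisms; $\partial_i$ ($i\ge1$) omits $x_i$ and composes; $\partial_0$ gives $x_1\to\dots\to x_n\xrightarrow{T(f_0)f_n}T(x_1)$; degeneracies insert identities. Duality: $P_n$ sends this to $P(x_n)\to\cdots\to P(x_0)\xrightarrow{TP(f_n)\circ\lambda_{x_0}}TP(x_n)$, with $\Theta_{n,x_\bullet}=(\Theta_{x_0},\dots,\Theta_{x_n},T(\Theta_{x_0}))$. With $\mathbf n=\{0<\dots<n<n'<\dots<0'\}\cong[2n+1]$ and the edgewise subdivision $X^e_n=X_{2n+1}$ ($\partial^e_i=\partial_i\partial_{2n+1-i}$, similarly for degeneracies), $\mathcal NC^{T,e}_\bullet(\mathcal C)$ is a simplicial category with duality with duality-preserving structure maps, and $\mathcal NU^T_n(\mathcal C):=(\mathcal NC^{T}_{2n+1}(\mathcal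 C),P_{2n+1},\Theta_{2n+1})_h$. Explicitly, objects are diagrams $x_0\to\dots\to x_n\to x_{n'}\to\dots\to x_{0'}\to T(x_0)$ with symmetric isomorphisms $\psi_j:x_j\to P(x_{j'})$. $F_\bullet$ is the forgetful morphism induced by the inclusions $[n]\hookrightarrow\mathbf n$, sending such an object to $x_0\to\dots\to x_n\to T(x_0)$ (the last arrow the composite). *)

(* Defs.v *)
From Stdlib Require Import ProofIrrelevance FunctionalExtensionality.
From HB Require Import structures.
From mathcomp Require Import all_boot zify.
From Stdlib Require Import Lia.

Set Implicit Arguments.
Unset Strict Implicit.
Unset Printing Implicit Defensive.

Inductive STrue : SProp := sI.
Inductive SFalse : SProp := .
Definition sle (b : bool) : SProp := if b then STrue else SFalse.
Definition sle_of (b : bool) : b -> sle b :=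
  match b return b -> sle b with
  | true => fun _ => sI
  | false => fun h => match (match h in _ = c return (if c then False else True) with erefl => I end)
                   return sle false with end
  end.
Definition of_sle (b : bool) : sle b -> b :=
  match b return sle b -> b with
  | true => fun _ => erefl
  | false => fun s => match s with end
  end.

Record Cat := Cat_ {
  Ob :> Type;
  Hom : Ob -> Ob -> Type;
  idm : forall a, Hom a a;
  comp : forall a b c, Hom b c -> Hom a b -> Hom a c;
  comp1f : forall a b (f : Hom a b), comp (idm b) f = f;
  compf1 : forall a b (f : Hom a b), comp f (idm a) = f;
  compA : forall a b c d (h : Hom c d) (g : Hom b c) (f : Hom a b),
      comp h (comp g f) = comp (comp h g) f }.
Arguments Hom {_} _ _.
Arguments idm {_} _.
Arguments comp {_ _ _ _} _ _.
Notation "g ⊚ f" := (comp g f) (at level 40, left associativity).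

Definition is_iso {C : Cat} {a b : C} (f : Hom a b) : Prop :=
  exists g : Hom b a, g ⊚ f = idm a /\ f ⊚ g = idm b.

Record Functor (C D : Cat) := Functor_ {
  Fo :> C -> D;
  Fm : forall a b, @Hom C a b -> Hom (Fo a) (Fo b);
  Fm_id : forall a, Fm (idm a) = idm (Fo a);
  Fm_comp : forall a b c (g : Hom b c) (f : Hom a b), Fm (g ⊚ f) = Fm g ⊚ Fm f }.
Arguments Fm {_ _} _ {_ _} _.

Definition Cop (C : Cat) : Cat.
Proof.
refine (@Cat_ (Ob C) (fun a b => @Hom C b a) (fun a => idm a)
          (fun a b c g f => f ⊚ g) _ _ _).
- by move=> a b f; exact: compf1.
- by move=> a b f; exact: comp1f.
- by move=> a b c d h g f; rewrite compA.
Defined.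

Record Duality (C : Cat) := Duality_ {
  dP : Functor (Cop C) C;
  dTh : forall x : C, Hom x (dP (dP x));
  dTh_iso : forall x : C, is_iso (dTh x);
  dTh_nat : forall (x y : C) (f : Hom x y),
      dTh y ⊚ f = @Fm _ _ dP (dP x) (dP y) (@Fm _ _ dP y x f) ⊚ dTh x;
  dTh_coh : forall U : C, @Fm _ _ dP (dP (dP U)) U (dTh U) ⊚ dTh (dP U) = idm (dP U) }.

Definition Pm {C : Cat} (D : Duality C) {x y : C} (f : Hom x y) : Hom (dP D y) (dP D x) :=
  @Fm _ _ (dP D) y x f.

Lemma Pm_comp {C : Cat} (D : Duality C) (x y z : C) (g : Hom y z) (f : Hom x y) :
  Pm D (g ⊚ f) = Pm D f ⊚ Pm D g.
Proof. exact: (@Fm_comp _ _ (dP D) z y x f g). Qed.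

Lemma Pm_id {C : Cat} (D : Duality C) (x : C) : Pm D (idm x) = idm _.
Proof. exact: (@Fm_id _ _ (dP D) x). Qed.

Definition lam_nat {C : Cat} (D : Duality C) (T : Functor C C)
  (lam : forall x : C, Hom (dP D x) (T (dP D (T x)))) : Prop :=
  forall (x y : C) (f : Hom x y), lam x ⊚ Pm D f = Fm T (Pm D (Fm T f)) ⊚ lam y.

Definition lam_coh {C : Cat} (D : Duality C) (T : Functor C C)
  (lam : forall x : C, Hom (dP D x) (T (dP D (T x)))) : Prop :=
  forall x : C, Fm T (Pm D (lam x)) ⊚ (lam (dP D (T x)) ⊚ dTh D (T x)) = Fm T (dTh D x).

Record Chain := Chain_ {
  cT :> Type;
  cle : cT -> cT -> bool;
  cle_refl : forall a, cle a a;
  cle_trans : forall a b c, cle a b -> cle b c -> cle a c;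
  cbot : cT;
  ctop : cT;
  cbot_le : forall a, cle cbot a;
  cle_top : forall a, cle a ctop }.

Definition ordC (m : nat) : Chain.
Proof.
refine (@Chain_ 'I_m.+1 (fun a b => (a <= b)%N) _ _ ord0 ord_max _ _).
- by move=> a; exact: leqnn.
- by move=> a b c; exact: leq_trans.
- by move=> a.
- by move=> a; exact: leq_ord.
Defined.

(* bold n = {0 < 1 < ... < n < n' < ... < 1' < 0'};  (false,k) = k, (true,k) = k' *)
Definition encle (n : nat) (a b : bool * 'I_n.+1) : bool :=
  if a.1 then b.1 && (b.2 <= a.2)%N else b.1 || (a.2 <= b.2)%N.

Definition enC (n : nat) : Chain.
Proof.
refine (@Chain_ (bool * 'I_n.+1)%type (@encle n) _ _ (false, ord0) (true, ord0) _ _).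
- by move=> [[] a]; rewrite /encle /= leqnn.
- move=> [[] a] [[] b] [[] c]; rewrite /encle //= => h1 h2; exact: leq_trans h2 h1 || exact: leq_trans h1 h2.
- by move=> [[] a].
- by move=> [[] a]; rewrite /encle /= ?leq0n.
Defined.

Definition erev (n : nat) (a : enC n) : enC n := (~~ a.1, a.2).

Lemma erev_le (n : nat) (a b : enC n) : cle a b -> cle (erev b) (erev a).
Proof. by move: a b => [[] a] [[] b]; rewrite /= /encle /=. Qed.

Definition srev (n : nat) (a b : enC n) (s : sle (cle a b)) : sle (cle (erev b) (erev a)) :=
  sle_of (erev_le (of_sle s)).

Record Mono (J K : Chain) := Mono_ {
  mf :> J -> K;
  mono : forall a b, cle a b -> cle (mf a) (mf b) }.

Definition smono (J K : Chain) (f : Mono J K) (a b : J) (s : sle (cle a b)) :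
  sle (cle (f a) (f b)) := sle_of (mono f (of_sle s)).

Definition compM (J K L : Chain) (g : Mono K L) (f : Mono J K) : Mono J L :=
  @Mono_ J L (fun a => g (f a)) (fun a b h => mono g (mono f h)).

(* edgewise subdivision: alpha : [m] -> [n] induces bold m -> bold n *)
Definition ewM (m n : nat) (al : Mono (ordC m) (ordC n)) : Mono (enC m) (enC n).
Proof.
refine (@Mono_ (enC m) (enC n) (fun a => (a.1, al a.2)) _).
move=> [[] a] [[] b]; rewrite /= /encle //=; exact: (mono al).
Defined.

Definition inclM (n : nat) : Mono (ordC n) (enC n).
Proof. by refine (@Mono_ (ordC n) (enC n) (fun p => (false, p)) _). Defined.

Lemma clamp_lt (x n : nat) : minn x n < n.+1.
Proof. by rewrite ltnS geq_minr. Qed.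

Definition clampM (m n : nat) (f : nat -> nat) (Hf : {homo f : p q / (p <= q)%N}) :
  Mono (ordC m) (ordC n).
Proof.
refine (@Mono_ (ordC m) (ordC n)
          (fun p : 'I_m.+1 => Ordinal (clamp_lt (f p) n)) _).
move=> p q /= pq; rewrite leq_min geq_minr andbT.
exact: leq_trans (geq_minl _ _) (Hf _ _ pq).
Defined.

(* Minimal groupoid infrastructure: objects, morphisms (and composition *)
(* where needed); raw functors; equivalences of groupoids; 2-pullbacks  *)
Record Gph := Gph_ { gob :> Type; ghom : gob -> gob -> Type }.
Arguments ghom : clear implicits.
Record Gpd := Gpd_ {
  gph :> Gph;
  gcomp : forall a b c : gph, ghom gph b c -> ghom gph a b -> ghom gph a c }.
Arguments gcomp {_ _ _ _} _ _.

Record RawFun (A B : Gph) := RawFun_ {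
  rfo :> A -> B;
  rfm : forall a b : A, ghom A a b -> ghom B (rfo a) (rfo b) }.
Arguments rfm {_ _} _ {_ _} _.

Definition compRF (A B C : Gph) (F : RawFun A B) (G : RawFun B C) : RawFun A C :=
  @RawFun_ A C (fun a => G (F a)) (fun a b u => rfm G (rfm F u)).

(* equivalence of groupoids: fully faithful and essentially surjective
   (in a groupoid every morphism is invertible) *)
Definition gequiv (A B : Gph) (F : RawFun A B) : Prop :=
  (forall a a' : A, bijective (@rfm A B F a a')) /\
  (forall b : B, exists a : A, inhabited (ghom B (F a) b)).

Section PB.
Context (A B : Gph) (C : Gpd) (F : RawFun A C) (G : RawFun B C).
Record PBobj := PBobj_ { pa : A; pb : B; pph : ghom C (F pa) (G pb) }.
Record PBhom (x y : PBobj) := PBhom_ {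
  qa : ghom A (pa x) (pa y);
  qb : ghom B (pb x) (pb y);
  qcomm : gcomp (rfm G qb) (pph x) = gcomp (pph y) (rfm F qa) }.
Definition Pullback : Gph := @Gph_ PBobj PBhom.

Definition pbFun (S : Gph) (f : RawFun S A) (g : RawFun S B)
  (eta : forall s : S, ghom C (F (f s)) (G (g s)))
  (eta_nat : forall (s s' : S) (u : ghom S s s'),
      gcomp (rfm G (rfm g u)) (eta s) = gcomp (eta s') (rfm F (rfm f u))) :
  RawFun S Pullback :=
  @RawFun_ S Pullback (fun s => PBobj_ (eta s))
    (fun s s' u => @PBhom_ (PBobj_ (eta s)) (PBobj_ (eta s')) _ _ (eta_nat s s' u)).
End PB.

(* the iterated 2-pullback  Y1 x^R_Y0 Y1 x^R_Y0 ... x^R_Y0 Y1  (n factors),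
   written out: n objects of Y1 and isomorphisms  t(y_k) ~ s(y_{k+1}) *)
Section IPB.
Context (Y1 : Gph) (Y0 : Gpd) (s t : RawFun Y1 Y0) (n : nat).
Record IPobj := IPobj_ {
  ipy : 'I_n -> Y1;
  ipph : forall k k' : 'I_n, k' = k.+1 :> nat -> ghom Y0 (t (ipy k)) (s (ipy k')) }.
Record IPhom (x y : IPobj) := IPhom_ {
  ipq : forall k : 'I_n, ghom Y1 (ipy x k) (ipy y k);
  ipcomm : forall (k k' : 'I_n) (e : k' = k.+1 :> nat),
      gcomp (rfm s (ipq k')) (ipph x e) = gcomp (ipph y e) (rfm t (ipq k)) }.
Definition IPullback : Gph := @Gph_ IPobj IPhom.
End IPB.

(* The groupoids NC^T_J(C): diagrams of shape J (a functor J -> C, i.e. *)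
(* the chain x_0 -> ... -> x_top together with all composites hx) plus  *)
(* the closing arrow x_top -> T(x_bot), recorded through all the        *)
(* composites kx a b : x_b -> x_top -> T x_bot -> T x_a.               *)
Section NC.
Context (C : Cat) (T : Functor C C).

Record NCdata (J : Chain) := NCdata_ {
  vx : J -> C;
  hx : forall a b : J, sle (cle a b) -> Hom (vx a) (vx b);
  kx : forall a b : J, Hom (vx b) (T (vx a)) }.
Arguments vx {_} _ _.
Arguments hx {_} _ _ _ _.
Arguments kx {_} _ _ _.

Record NClaws (J : Chain) (d : NCdata J) : Prop := NClaws_ {
  law_h1 : forall a s, hx d a a s = idm _;
  law_hh : forall a b c s1 s2 s3, hx d b c s2 ⊚ hx d a b s1 = hx d a c s3;
  law_kh : forall a b b' s, kx d a b ⊚ hx d b' b s = kx d a b';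
  law_Tk : forall a a' b s, Fm T (hx d a a' s) ⊚ kx d a b = kx d a' b }.

Arguments law_h1 {_ _} _ _ _.
Arguments law_hh {_ _} _ _ _ _ _ _ _.
Arguments law_kh {_ _} _ _ _ _ _.
Arguments law_Tk {_ _} _ _ _ _ _.

Record NCobj (J : Chain) := NCobj_ { od :> NCdata J; olaws : NClaws od }.

Record NChom (J : Chain) (d e : NCdata J) := NChom_ {
  cm : forall a, Hom (vx d a) (vx e a);
  cm_iso : forall a, is_iso (cm a);
  cm_h : forall a b s, cm b ⊚ hx d a b s = hx e a b s ⊚ cm a;
  cm_k : forall a b, Fm T (cm a) ⊚ kx d a b = kx e a b ⊚ cm b }.
Arguments cm {_ _ _} _ _.
Arguments cm_iso {_ _ _} _ _.
Arguments cm_h {_ _ _} _ _ _ _.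
Arguments cm_k {_ _ _} _ _ _.

Lemma hom_eq (J : Chain) (d e : NCdata J) (f g : NChom d e) :
  (forall a, cm f a = cm g a) -> f = g.
Proof.
case: f g => [f fi fh fk] [g gi gh gk] /= H.
have E : f = g by apply: functional_extensionality_dep.
subst g; f_equal; apply: proof_irrelevance.
Qed.

Lemma iso_comp (a b c : C) (g : Hom b c) (f : Hom a b) :
  is_iso g -> is_iso f -> is_iso (g ⊚ f).
Proof.
move=> [g' [g1 g2]] [f' [f1 f2]]; exists (f' ⊚ g'); split.
- by rewrite -compA (compA g') g1 comp1f.
- by rewrite -compA (compA f) f2 comp1f.
Qed.

Definition NCcomp (J : Chain) (d e k : NCdata J) (g : NChom e k) (f : NChom d e) :
  NChom d k.
Proof.
refine (@NChom_ J d k (fun a => cm g a ⊚ cm f a) _ _ _).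
- by move=> a; apply: iso_comp; apply: cm_iso.
- by move=> a b s; rewrite -compA cm_h compA cm_h compA.
- by move=> a b; rewrite Fm_comp -compA cm_k compA cm_k compA.
Defined.

Definition NCgpd (J : Chain) : Gpd :=
  @Gpd_ (@Gph_ (NCobj J) (fun x y => NChom (od x) (od y)))
        (fun x y z g f => NCcomp g f).

Definition resD (J K : Chain) (f : Mono K J) (d : NCdata J) : NCdata K :=
  @NCdata_ K (fun a => vx d (f a)) (fun a b s => hx d (f a) (f b) (smono f s))
           (fun a b => kx d (f a) (f b)).

Lemma resD_laws (J K : Chain) (f : Mono K J) (x : NCobj J) : NClaws (resD f x).
Proof.
case: x => d [L1 L2 L3 L4]; split => /=.
- by move=> a s; apply: L1.
- by move=> a b c s1 s2 s3; apply: L2.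
- by move=> a b b' s; apply: L3.
- by move=> a a' b s; apply: L4.
Qed.

Definition resO (J K : Chain) (f : Mono K J) (x : NCobj J) : NCobj K :=
  @NCobj_ K (resD f x) (resD_laws f x).

Definition resH (J K : Chain) (f : Mono K J) (d e : NCdata J) (u : NChom d e) :
  NChom (resD f d) (resD f e).
Proof.
refine (@NChom_ K (resD f d) (resD f e) (fun a => cm u (f a)) _ _ _).
- by move=> a; exact: (cm_iso u (f a)).
- by move=> a b s; exact: (cm_h u (f a) (f b) (smono f s)).
- by move=> a b; exact: (cm_k u (f a) (f b)).
Defined.

Definition resX (J K : Chain) (f : Mono K J) : RawFun (NCgpd J) (NCgpd K) :=
  @RawFun_ (NCgpd J) (NCgpd K) (resO f) (fun x y u => resH f u).

Lemma cle_of_eq (J : Chain) (a b : J) : a = b -> cle a b.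
Proof. by move=> ->; apply: cle_refl. Qed.

Definition reidx (J K : Chain) (x : NCobj J) (f g : Mono K J) (H : forall a, f a = g a) :
  NChom (resD f x) (resD g x).
Proof.
refine (@NChom_ K (resD f x) (resD g x)
          (fun a => hx x (f a) (g a) (sle_of (cle_of_eq (H a)))) _ _ _).
- move=> a; exists (hx x (g a) (f a) (sle_of (cle_of_eq (esym (H a))))).
  case: (olaws x) => L1 L2 _ _.
  by rewrite !(L2 _ _ _ _ _ (sle_of (cle_refl _))) !L1.
- move=> a b s /=; case: (olaws x) => _ L2 _ _.
  have c3 : cle (f a) (g b) by apply: cle_trans (mono f (of_sle s)) (cle_of_eq (H b)).
  by rewrite (L2 _ _ _ _ _ (sle_of c3)) (L2 _ _ _ _ _ (sle_of c3)).
- move=> a b /=; case: (olaws x) => _ _ L3 L4.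
  by rewrite L4 L3.
Defined.
End NC.
Arguments vx {C T J} _ _.
Arguments hx {C T J} _ _ _ _.
Arguments kx {C T J} _ _ _.
Arguments cm {C T J d e} _ _.
Arguments cm_iso {C T J d e} _ _.
Arguments cm_h {C T J d e} _ _ _ _.
Arguments cm_k {C T J d e} _ _ _.
Arguments law_h1 {C T J d} _ _ _.
Arguments law_hh {C T J d} _ _ _ _ _ _ _.
Arguments law_kh {C T J d} _ _ _ _ _.
Arguments law_Tk {C T J d} _ _ _ _ _.

Section Dual.
Context (C : Cat) (D : Duality C) (T : Functor C C)
        (lam : forall x : C, Hom (dP D x) (T (dP D (T x))))
        (Hnat : lam_nat lam) (Hcoh : lam_coh lam).

Local Notation P := (dP D).

(* P(x_top) -> ... -> P(x_bot),  closing arrow  T P(f_top) o lam_{x_0} *)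
Definition PeD (n : nat) (d : @NCdata C T (enC n)) : @NCdata C T (enC n) :=
  @NCdata_ C T (enC n) (fun a => P (vx d (erev a)))
    (fun a b s => Pm D (hx d (erev b) (erev a) (srev s)))
    (fun a b => Fm T (Pm D (kx d (erev b) (erev a))) ⊚ lam (vx d (erev b))).

Lemma PeD_laws (n : nat) (x : @NCobj C T (enC n)) : NClaws (PeD x).
Proof.
case: x => d L; split => /=.
- by move=> a s; rewrite law_h1 // Pm_id.
- by move=> a b c s1 s2 s3; rewrite -Pm_comp (law_hh L _ _ _ _ _ (srev s3)).
- move=> a b b' s; rewrite -compA Hnat compA -Fm_comp -Pm_comp.
  by rewrite (law_Tk L).
- move=> a a' b s; rewrite compA -Fm_comp -Pm_comp.
  by rewrite (law_kh L).
Qed.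

Definition PeO (n : nat) (x : @NCobj C T (enC n)) : @NCobj C T (enC n) :=
  @NCobj_ C T (enC n) (PeD x) (PeD_laws x).

Lemma Pm_iso (x y : C) (f : Hom x y) : is_iso f -> is_iso (Pm D f).
Proof.
move=> [g [g1 g2]]; exists (Pm D g); split.
- by rewrite -Pm_comp g2 Pm_id.
- by rewrite -Pm_comp g1 Pm_id.
Qed.

Lemma FT_iso (x y : C) (f : Hom x y) : is_iso f -> is_iso (Fm T f).
Proof.
move=> [g [g1 g2]]; exists (Fm T g); split.
- by rewrite -Fm_comp g1 Fm_id.
- by rewrite -Fm_comp g2 Fm_id.
Qed.

Definition PeH (n : nat) (d e : @NCdata C T (enC n)) (u : NChom d e) :
  NChom (PeD e) (PeD d).
Proof.
refine (@NChom_ C T (enC n) (PeD e) (PeD d) (fun a => Pm D (cm u (erev a))) _ _ _).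
- by move=> a; apply: Pm_iso; exact: (cm_iso u).
- by move=> a b s /=; rewrite -!Pm_comp (cm_h u).
- move=> a b /=.
  rewrite compA -Fm_comp -Pm_comp -(cm_k u) Pm_comp Fm_comp -compA -Hnat.
  by rewrite compA.
Defined.

Definition ThCm (n : nat) (d : @NCdata C T (enC n)) (a : enC n) :
  Hom (vx d a) (vx (PeD (PeD d)) a) :=
  match a as a0 return Hom (vx d a0) (vx (PeD (PeD d)) a0) with
  | (b, k) =>
      match b as b0 return Hom (vx d (b0, k)) (vx (PeD (PeD d)) (b0, k)) with
      | true => dTh D (vx d (true, k))
      | false => dTh D (vx d (false, k))
      end
  end.

Definition Theta (n : nat) (d : @NCdata C T (enC n)) : NChom d (PeD (PeD d)).
Proof.
refine (@NChom_ C T (enC n) d (PeD (PeD d)) (ThCm d) _ _ _).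
- by move=> [[] k]; exact: dTh_iso.
- by move=> [[] a] [[] b] s /=; exact: dTh_nat.
- move=> [[] a] [[] b] /=;
  rewrite Pm_comp Fm_comp -(compA (Fm T (Pm D (lam _)))) -Hnat -!compA -dTh_nat;
  by rewrite (compA (lam _)) compA Hcoh.
Defined.

(* the Hermitian groupoid NU^T_n(C) = (NC^T_{2n+1}(C), P, Theta)_h *)
Record NUobj (n : nat) := NUobj_ {
  ux : @NCobj C T (enC n);
  upsi : NChom (od ux) (PeD ux);
  usym : forall a, cm (NCcomp (PeH upsi) (Theta ux)) a = cm upsi a }.

(* isometries, written out componentwise:  P(phi) o psi_z o phi = psi_y
   (the type only depends on the underlying diagrams and forms) *)
Record NUhom (n : nat) (d e : @NCdata C T (enC n))
    (pd : forall a, Hom (vx d a) (vx (PeD d) a))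
    (pe : forall a, Hom (vx e a) (vx (PeD e) a)) := NUhom_ {
  uphi : NChom d e;
  uiso : forall a, (Pm D (cm uphi (erev a)) ⊚ pe a) ⊚ cm uphi a = pd a }.
Arguments uphi {n d e pd pe} _.
Arguments uiso {n d e pd pe} _ _.

Definition NUghom (n : nat) (y z : NUobj n) : Type :=
  @NUhom n (ux y) (ux z) (cm (upsi y)) (cm (upsi z)).

Definition NUcomp (n : nat) (y z w : NUobj n) (g : NUghom z w) (f : NUghom y z) :
  NUghom y w.
Proof.
refine (@NUhom_ n _ _ _ _ (NCcomp (uphi g) (uphi f)) _).
move=> a; have Hg := uiso g a; have Hf := uiso f a; move: Hg Hf => /= Hg Hf.
by rewrite Pm_comp -Hf -Hg !compA.
Defined.

Definition NUgpd (n : nat) : Gpd :=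
  @Gpd_ (@Gph_ (NUobj n) (@NUghom n)) (fun y z w g f => NUcomp g f).

Definition resU (m k : nat) (al : Mono (ordC k) (ordC m)) (y : NUobj m) : NUobj k.
Proof.
refine (@NUobj_ k (resO (ewM al) (ux y)) (resH (ewM al) (upsi y)) _).
by move=> [[] a]; exact: (usym y (_, al a)).
Defined.

Definition resUH (m k : nat) (al : Mono (ordC k) (ordC m)) (y z : NUobj m)
  (u : NUghom y z) : NUghom (resU al y) (resU al z) :=
  @NUhom_ k _ _ _ _ (resH (ewM al) (uphi u)) (fun a => uiso u (ewM al a)).

Definition resUF (m k : nat) (al : Mono (ordC k) (ordC m)) : RawFun (NUgpd m) (NUgpd k) :=
  @RawFun_ (NUgpd m) (NUgpd k) (resU al) (fun y z u => resUH al u).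

Lemma ewM_eq (m k : nat) (f g : Mono (ordC k) (ordC m)) :
  (forall a, f a = g a) -> forall a, ewM f a = ewM g a.
Proof. by move=> H a /=; rewrite H. Qed.

Definition reidxU (m k : nat) (y : NUobj m) (f g : Mono (ordC k) (ordC m))
  (H : forall a, f a = g a) : NUghom (resU f y) (resU g y).
Proof.
refine (@NUhom_ k _ _ _ _ (reidx (ux y) (ewM_eq H)) _).
move=> a /=.
rewrite -compA (cm_h (upsi y)) compA /= -Pm_comp (law_hh (olaws (ux y)) _ _ _ _ _ (sle_of (cle_refl _))).
rewrite (law_h1 (olaws (ux y))).
by rewrite Pm_id comp1f.
Defined.

Definition Fnu (n : nat) : RawFun (NUgpd n) (@NCgpd C T (ordC n)) :=
  @RawFun_ (NUgpd n) (@NCgpd C T (ordC n)) (fun y => resO (inclM n) (ux y))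
    (fun y z u => resH (inclM n) (uphi u)).
End Dual.

Definition segf (i p : nat) : nat := i + p.
Definition cutf (i j p : nat) : nat := if (p <= i)%N then p else p + (j - i).-1.
Definition edgef (i j p : nat) : nat := i + p * (j - i).
Definition ptf (i p : nat) : nat := i.
Definition degf (i p : nat) : nat := if (p <= i)%N then p else p.-1.

Lemma segf_homo i : {homo segf i : p q / (p <= q)%N}.
Proof. by move=> p q pq; rewrite /segf leq_add2l. Qed.
Lemma cutf_homo i j : {homo cutf i j : p q / (p <= q)%N}.
Proof. by move=> p q pq; rewrite /cutf; case: ifP => h1; case: ifP => h2; lia. Qed.
Lemma edgef_homo i j : {homo edgef i j : p q / (p <= q)%N}.
Proof. by move=> p q pq; rewrite /edgef leq_add2l leq_mul2r pq orbT. Qed.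
Lemma ptf_homo i : {homo ptf i : p q / (p <= q)%N}.
Proof. by []. Qed.
Lemma degf_homo i : {homo degf i : p q / (p <= q)%N}.
Proof. by move=> p q pq; rewrite /degf; case: ifP => h1; case: ifP => h2; lia. Qed.

Definition segM (n i j : nat) : Mono (ordC (j - i)) (ordC n) := clampM (j - i) n (segf_homo i).
(* {0, ..., i, j, ..., n} -> [n] *)
Definition cutM (n i j : nat) : Mono (ordC (n - (j - i)).+1) (ordC n) :=
  clampM (n - (j - i)).+1 n (cutf_homo i j).
(* {i, j} -> [m] *)
Definition edgM (m i j : nat) : Mono (ordC 1) (ordC m) := clampM 1 m (edgef_homo i j).
Definition ptM (m i : nat) : Mono (ordC 0) (ordC m) := clampM 0 m (ptf_homo i).
Definition degM (n i : nat) : Mono (ordC n) (ordC n.-1) := clampM n n.-1 (degf_homo i).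

Lemma seg_cut_eq (n i j : nat) (Hij : (i < j)%N) (Hjn : (j <= n)%N) :
  forall a, compM (segM n i j) (edgM (j - i) 0 (j - i)) a
          = compM (cutM n i j) (edgM (n - (j - i)).+1 i i.+1) a.
Proof.
move=> [[|[|a]] Ha] //; apply: val_inj; rewrite /= /segf /edgef /cutf;
  case: ifP => h; lia.
Qed.

Lemma edge_edge_eq (n : nat) (k k' : 'I_n) (e : k' = k.+1 :> nat) :
  forall a, compM (edgM n k k.+1) (ptM 1 1) a = compM (edgM n k' k'.+1) (ptM 1 0) a.
Proof.
move=> [[|a] Ha] //; apply: val_inj; rewrite /= /edgef /ptf.
move: (ltn_ord k'); lia.
Qed.

Lemma pt_deg_eq (n i : nat) (Hn : (2 <= n)%N) (Hi : (i <= n.-1)%N) :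
  forall a, compM (compM (ewM (ptM n.-1 i)) (inclM 0)) (clampM 1 0 (ptf_homo 0)) a
          = compM (compM (ewM (degM n i)) (inclM n)) (edgM n i i.+1) a.
Proof.
move=> [[|[|a]] Ha] //=; congr pair; apply: val_inj;
  rewrite /= /ptf /degf /edgef; case: ifP => h; lia.
Qed.

Lemma seg_cut_eqe (n i j : nat) (Hij : (i < j)%N) (Hjn : (j <= n)%N) :
  forall a, compM (compM (ewM (segM n i j)) (inclM (j - i))) (edgM (j - i) 0 (j - i)) a
          = compM (compM (ewM (cutM n i j)) (inclM (n - (j - i)).+1))
                  (edgM (n - (j - i)).+1 i i.+1) a.
Proof.
move=> a /=; congr pair.
exact: (seg_cut_eq Hij Hjn a).
Qed.

Section Segal.
Context (C : Cat) (D : Duality C) (T : Functor C C)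
        (lam : forall x : C, Hom (dP D x) (T (dP D (T x))))
        (Hnat : lam_nat lam) (Hcoh : lam_coh lam).

Lemma X2S_nat (n i j : nat) (Hij : (i < j)%N) (Hjn : (j <= n)%N)
  (s s' : NCgpd T (ordC n)) (u : ghom (NCgpd T (ordC n)) s s') :
  NCcomp (resH (edgM (n - (j - i)).+1 i i.+1) (resH (cutM n i j) u))
         (reidx s (seg_cut_eq Hij Hjn))
  = NCcomp (reidx s' (seg_cut_eq Hij Hjn))
           (resH (edgM (j - i) 0 (j - i)) (resH (segM n i j) u)).
Proof. by apply: hom_eq => a /=; exact: (cm_h u). Qed.

Definition X2Sfun (n i j : nat) (Hij : (i < j)%N) (Hjn : (j <= n)%N) :
  RawFun (NCgpd T (ordC n))
    (Pullback (resX T (edgM (j - i) 0 (j - i))) (resX T (edgM (n - (j - i)).+1 i i.+1))) :=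
  @pbFun _ _ (NCgpd T (ordC 1))
    (resX T (edgM (j - i) 0 (j - i))) (resX T (edgM (n - (j - i)).+1 i i.+1))
    (NCgpd T (ordC n)) (resX T (segM n i j)) (resX T (cutM n i j))
    (fun s => reidx s (seg_cut_eq Hij Hjn)) (X2S_nat Hij Hjn).

Definition NC_2Segal : Prop :=
  forall (n i j : nat) (H3 : (3 <= n)%N) (Hij : (i < j)%N) (Hjn : (j <= n)%N),
    gequiv (X2Sfun Hij Hjn).

Lemma NUhom_eq (n : nat) (d e : @NCdata C T (enC n))
  (pd : forall a, Hom (vx d a) (vx (PeD lam d) a))
  (pe : forall a, Hom (vx e a) (vx (PeD lam e) a))
  (f g : NUhom pd pe) : uphi f = uphi g -> f = g.
Proof.
destruct f as [f fi]; destruct g as [g gi]; simpl; intros E; subst g; f_equal.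
apply: proof_irrelevance.
Qed.

Definition Y1Sobj (n : nat) (y : NUgpd Hnat Hcoh n) :
  IPullback (resUF Hnat Hcoh (ptM 1 0)) (resUF Hnat Hcoh (ptM 1 1)) n :=
  @IPobj_ _ _ (resUF Hnat Hcoh (ptM 1 0)) (resUF Hnat Hcoh (ptM 1 1)) n
    (fun k : 'I_n => resU (edgM n k k.+1) y)
    (fun k k' e => reidxU y (edge_edge_eq e)).

Lemma Y1S_nat (n : nat) (y z : NUgpd Hnat Hcoh n) (u : ghom (NUgpd Hnat Hcoh n) y z)
  (k k' : 'I_n) (e : k' = k.+1 :> nat) :
  gcomp (rfm (resUF Hnat Hcoh (ptM 1 0)) (resUH (edgM n k' k'.+1) u))
        (ipph (Y1Sobj y) e)
  = gcomp (ipph (Y1Sobj z) e)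
          (rfm (resUF Hnat Hcoh (ptM 1 1)) (resUH (edgM n k k.+1) u)).
Proof.
apply: NUhom_eq; apply: hom_eq => a /=; exact: (cm_h (uphi u)).
Qed.

Definition Y1Sfun (n : nat) :
  RawFun (NUgpd Hnat Hcoh n)
    (IPullback (resUF Hnat Hcoh (ptM 1 0)) (resUF Hnat Hcoh (ptM 1 1)) n) :=
  @RawFun_ (NUgpd Hnat Hcoh n) _ (@Y1Sobj n)
    (fun y z u => @IPhom_ _ _ _ _ n (Y1Sobj y) (Y1Sobj z)
                    (fun k => resUH (edgM n k k.+1) u) (Y1S_nat u)).

Definition NU_1Segal : Prop :=
  forall (n : nat) (H2 : (2 <= n)%N), gequiv (Y1Sfun n).
End Segal.

Section Relative.
Context (C : Cat) (D : Duality C) (T : Functor C C)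
        (lam : forall x : C, Hom (dP D x) (T (dP D (T x))))
        (Hnat : lam_nat lam) (Hcoh : lam_coh lam).

Local Notation NU := (NUgpd Hnat Hcoh).
Local Notation FF := (Fnu Hnat Hcoh).

Definition R2Seta (n i j : nat) (Hij : (i < j)%N) (Hjn : (j <= n)%N) (s : NU n) :
  ghom (NCgpd T (ordC 1))
    (resX T (edgM (j - i) 0 (j - i)) (compRF (resUF Hnat Hcoh (segM n i j)) (FF (j - i)) s))
    (compRF (FF (n - (j - i)).+1) (resX T (edgM (n - (j - i)).+1 i i.+1))
       (resUF Hnat Hcoh (cutM n i j) s)) :=
  reidx (ux s) (seg_cut_eqe Hij Hjn).

Lemma R2S_nat (n i j : nat) (Hij : (i < j)%N) (Hjn : (j <= n)%N)
  (s s' : NU n) (u : ghom (NU n) s s') :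
  gcomp (rfm (compRF (FF (n - (j - i)).+1) (resX T (edgM (n - (j - i)).+1 i i.+1)))
           (rfm (resUF Hnat Hcoh (cutM n i j)) u))
        (R2Seta Hij Hjn s)
  = gcomp (R2Seta Hij Hjn s')
          (rfm (resX T (edgM (j - i) 0 (j - i)))
             (rfm (compRF (resUF Hnat Hcoh (segM n i j)) (FF (j - i))) u)).
Proof. by apply: hom_eq => a /=; exact: (cm_h (uphi u)). Qed.

Definition R2Sfun (n i j : nat) (Hij : (i < j)%N) (Hjn : (j <= n)%N) :
  RawFun (NU n)
    (Pullback (resX T (edgM (j - i) 0 (j - i)))
              (compRF (FF (n - (j - i)).+1) (resX T (edgM (n - (j - i)).+1 i i.+1)))) :=
  @pbFun _ _ (NCgpd T (ordC 1))
    (resX T (edgM (j - i) 0 (j - i)))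
    (compRF (FF (n - (j - i)).+1) (resX T (edgM (n - (j - i)).+1 i i.+1)))
    (NU n) (compRF (resUF Hnat Hcoh (segM n i j)) (FF (j - i)))
    (resUF Hnat Hcoh (cutM n i j))
    (R2Seta Hij Hjn) (R2S_nat Hij Hjn).

Definition F_rel2Segal : Prop :=
  forall (n i j : nat) (H2 : (2 <= n)%N) (Hij : (i < j)%N) (Hjn : (j <= n)%N),
    gequiv (R2Sfun Hij Hjn).

Definition Ueta (n i : nat) (Hn : (2 <= n)%N) (Hi : (i <= n.-1)%N) (s : NU n.-1) :
  ghom (NCgpd T (ordC 1))
    (resX T (clampM 1 0 (ptf_homo 0)) (compRF (resUF Hnat Hcoh (ptM n.-1 i)) (FF 0) s))
    (compRF (FF n) (resX T (edgM n i i.+1)) (resUF Hnat Hcoh (degM n i) s)) :=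
  reidx (ux s) (pt_deg_eq Hn Hi).

Lemma U_nat (n i : nat) (Hn : (2 <= n)%N) (Hi : (i <= n.-1)%N)
  (s s' : NU n.-1) (u : ghom (NU n.-1) s s') :
  gcomp (rfm (compRF (FF n) (resX T (edgM n i i.+1)))
           (rfm (resUF Hnat Hcoh (degM n i)) u))
        (Ueta Hn Hi s)
  = gcomp (Ueta Hn Hi s')
          (rfm (resX T (clampM 1 0 (ptf_homo 0)))
             (rfm (compRF (resUF Hnat Hcoh (ptM n.-1 i)) (FF 0)) u)).
Proof. by apply: hom_eq => a /=; exact: (cm_h (uphi u)). Qed.

Definition Ufun (n i : nat) (Hn : (2 <= n)%N) (Hi : (i <= n.-1)%N) :
  RawFun (NU n.-1)
    (Pullback (resX T (clampM 1 0 (ptf_homo 0)))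
              (compRF (FF n) (resX T (edgM n i i.+1)))) :=
  @pbFun _ _ (NCgpd T (ordC 1))
    (resX T (clampM 1 0 (ptf_homo 0)))
    (compRF (FF n) (resX T (edgM n i i.+1)))
    (NU n.-1) (compRF (resUF Hnat Hcoh (ptM n.-1 i)) (FF 0))
    (resUF Hnat Hcoh (degM n i))
    (Ueta Hn Hi) (U_nat Hn Hi).

Definition F_unital : Prop :=
  forall (n i : nat) (Hn : (2 <= n)%N) (Hi : (i <= n.-1)%N), gequiv (Ufun Hn Hi).

Definition NU_unital_rel2Segal : Prop :=
  NC_2Segal T /\ NU_1Segal Hnat Hcoh /\ F_rel2Segal /\ F_unital.
End Relative.

(* Main.v *)
From Stdlib Require Import ProofIrrelevance FunctionalExtensionality IndefiniteDescription.
From mathcomp Require Import all_boot zify.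
From Stdlib Require Import Lia.
Require Import Defs.

(* All the maps in question restrict diagrams to sub-chains which cover the index chain.
   Full faithfulness holds because a morphism of diagrams is determined by its components and
   naturality is only needed on consecutive vertices and on the closing arrow, each of which
   lies in one of the pieces.  For essential surjectivity, a diagram on [K] is inserted into a
   diagram on [L] between two vertices [p] and [q], along an isomorphism of its ends with the
   edge [p -> q]; the closing arrows of the pieces determine each other.  The 2-Segal map
   is inverted by one such insertion; splitting off the last edge of a symmetric diagram
   inserts the innermost part [n < n+1 < (n+1)' < n'] between [n] and [n'], which gives the
   1-Segal condition by induction.  In the relative case the segment is inserted at [i < j] and
   its dual at [j' < i'].  The symmetric form is itself a morphism from the diagram to its dual,
   hence glued from the forms of the pieces and, on a segment and its dual, from [Theta] and the
   identity.  For unitality, if [y_i -> y_(i+1)] is invertible then so is its dual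
   [y_(i+1)' -> y_i'] and both can be contracted. *)

Set Implicit Arguments.
Unset Strict Implicit.
Unset Printing Implicit Defensive.

(** [bijective] asks for an inverse function, so preimages have to be chosen. *)
Lemma inj_surj_bij (A B : Type) (f : A -> B) :
  injective f -> (forall b, exists a, f a = b) -> bijective f.
Proof.
move=> inj /(fun h b => constructive_indefinite_description _ (h b)) sur.
exists (fun b => sval (sur b)) => [a|b]; last exact: (svalP (sur b)).
by apply: inj; rewrite (svalP (sur (f a))).
Qed.

Definition srefl (J : Chain) (a : J) : sle (cle a a) := sle_of (cle_refl a).
Definition strans (J : Chain) (a b c : J) (s : sle (cle a b)) (t : sle (cle b c)) :
  sle (cle a c) := sle_of (cle_trans (of_sle s) (of_sle t)).

(** * Cancelling and inverting isomorphisms *)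

Section Isomorphisms.
Context (C : Cat).

Lemma inv_unique (a b : C) (f : Hom a b) (g h : Hom b a) :
  g ⊚ f = idm a -> f ⊚ h = idm b -> g = h.
Proof. by move=> gf fh; rewrite -[LHS]compf1 -fh compA gf comp1f. Qed.

Lemma iso_monic (a b c : C) (f : Hom b c) (g h : Hom a b) :
  is_iso f -> f ⊚ g = f ⊚ h -> g = h.
Proof. by case=> f' [f'f _] E; rewrite -(comp1f g) -f'f -compA E compA f'f comp1f. Qed.

Lemma iso_epic (a b c : C) (f : Hom a b) (g h : Hom b c) :
  is_iso f -> g ⊚ f = h ⊚ f -> g = h.
Proof. by case=> f' [_ ff'] E; rewrite -(compf1 g) -ff' compA E -compA ff' compf1. Qed.

Lemma iso_linv (a b : C) (f : Hom a b) (g : Hom b a) :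
  is_iso f -> g ⊚ f = idm a -> f ⊚ g = idm b.
Proof. by case=> h [_ fh] gf; rewrite (inv_unique gf fh). Qed.

Lemma linv_iso (a b : C) (f : Hom a b) (g : Hom b a) :
  is_iso f -> g ⊚ f = idm a -> is_iso g.
Proof. by move=> fi gf; exists f; rewrite gf (iso_linv fi gf). Qed.

(** [is_iso] is a proposition; the inverse is extracted as data so that it can serve as a component
    of a morphism of diagrams. *)
Lemma iso_inv (a b : C) (f : Hom a b) :
  is_iso f -> {g : Hom b a | is_iso g /\ g ⊚ f = idm a /\ f ⊚ g = idm b}.
Proof.
case/constructive_indefinite_description => g [gf fg].
by exists g; split; [exists f | split].
Qed.
End Isomorphisms.

(** * Gluing diagrams *)

Section Diagrams.
Context (C : Cat) (T : Functor C C).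

Section Laws.
Context (J : Chain) (z : NCobj T J).
Local Notation L := (olaws z).

Lemma hx_id (a : J) (s : sle (cle a a)) : hx z a a s = idm _.
Proof. exact: law_h1 L a s. Qed.

Lemma hx_comp (a b c : J) (s : sle (cle a b)) (t : sle (cle b c)) :
  hx z b c t ⊚ hx z a b s = hx z a c (strans s t).
Proof. exact: law_hh L _ _ _ _ _ _. Qed.

Lemma kx_hx (a b b' : J) (s : sle (cle b' b)) : kx z a b ⊚ hx z b' b s = kx z a b'.
Proof. exact: law_kh L _ _ _ _. Qed.

Lemma Thx_kx (a a' b : J) (s : sle (cle a a')) : Fm T (hx z a a' s) ⊚ kx z a b = kx z a' b.
Proof. exact: law_Tk L _ _ _ _. Qed.

Lemma comp_hx_comp (a b c : J) (d : C) (f : Hom (vx z c) d) (s : sle (cle a b)) (t : sle (cle b c)) :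
  f ⊚ hx z b c t ⊚ hx z a b s = f ⊚ hx z a c (strans s t).
Proof. by rewrite -compA hx_comp. Qed.

Lemma comp_kx_hx (a b b' : J) (d : C) (f : Hom _ d) (s : sle (cle b' b)) :
  f ⊚ kx z a b ⊚ hx z b' b s = f ⊚ kx z a b'.
Proof. by rewrite -compA kx_hx. Qed.

Lemma hx_iso (a b : J) (s : sle (cle a b)) : cle b a -> is_iso (hx z a b s).
Proof.
move=> h; exists (hx z b a (sle_of h)); by rewrite !hx_comp !hx_id.
Qed.

(** Reduces claims about all closing composites to the single arrow from the greatest vertex to [T]
    of the least. *)
Lemma kx_bot_top (a b : J) :
  kx z a b = Fm T (hx z (cbot J) a (sle_of (cbot_le a))) ⊚ kx z (cbot J) (ctop J)
             ⊚ hx z b (ctop J) (sle_of (cle_top b)).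
Proof. by rewrite Thx_kx kx_hx. Qed.
End Laws.

Lemma NChom_inv (J : Chain) (d e : NCdata T J) (u : NChom d e) :
  {v : NChom e d | (forall a, cm v a ⊚ cm u a = idm _) /\
                   (forall a, cm u a ⊚ cm v a = idm _)}.
Proof.
have I a := iso_inv (cm_iso u a).
have H1 a : sval (I a) ⊚ cm u a = idm _ by case: (svalP (I a)) => _ [].
have H2 a : cm u a ⊚ sval (I a) = idm _ by case: (svalP (I a)) => _ [].
unshelve eexists (@NChom_ C T J e d (fun a => sval (I a)) _ _ _); last by [].
- by move=> a; case: (svalP (I a)).
- move=> a b s; apply: (iso_monic (cm_iso u b)).
  by rewrite !compA H2 comp1f cm_h -compA H2 compf1.
- move=> a b; apply: (iso_monic (FT_iso T (cm_iso u a))).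
  by rewrite !compA -Fm_comp H2 Fm_id comp1f cm_k -compA H2 compf1.
Qed.

(* Naturality is only needed along steps lying in one piece and for the closing arrow from
   the greatest to the least vertex, since these generate a diagram. *)
Section HomGluing.
Context (J : Chain) (I : Type) (K : I -> Chain) (f : forall i, Mono (K i) J).
Hypothesis cover : forall a, exists i k, f i k = a.
Hypothesis steps : forall R : J -> J -> Prop,
  (forall a, R a a) -> (forall a b c, R a b -> R b c -> R a c) ->
  (forall i k k', cle k k' -> R (f i k) (f i k')) -> forall a b, cle a b -> R a b.
Hypothesis ends : exists i k k', f i k = cbot J /\ f i k' = ctop J.
Context (d e : NCobj T J) (u : forall i, NChom (resD (f i) d) (resD (f i) e)).
Hypothesis agree : forall i k j l (s : sle (cle (f i k) (f j l))), f i k = f j l ->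
  cm (u j) l ⊚ hx d _ _ s = hx e _ _ s ⊚ cm (u i) k.

(** The component at [a] is that of a chosen preimage, transported along the arrows between [a] and
    [f i k], since these are equal only propositionally. By [agree] the choice does not matter. *)
Lemma hom_glue : exists w : NChom d e, forall i k, cm w (f i k) = cm (u i) k.
Proof.
have S a : {i : I & {k : K i | f i k = a}}.
  have [i /constructive_indefinite_description [k E]] :=
    constructive_indefinite_description _ (cover a).
  by exists i, k.
pose w a : Hom (vx d a) (vx e a) :=
  let: existT i (exist k E) := S a in
  hx e (f i k) a (sle_of (cle_of_eq E)) ⊚ cm (u i) k
  ⊚ hx d a (f i k) (sle_of (cle_of_eq (esym E))).
have wE i k : w (f i k) = cm (u i) k.
  rewrite /w; case: (S _) => j [l E].
  rewrite -compA (agree _ (esym E)) compA hx_comp.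
  by rewrite hx_id comp1f.
have wh : forall a b s, w b ⊚ hx d a b s = hx e a b s ⊚ w a.
  move=> a b s.
  (* The comparison itself is carried in the relation: transitivity has to factor the arrow through
     the middle vertex. *)
  suff: cle a b /\ forall s, w b ⊚ hx d a b s = hx e a b s ⊚ w a by case.
  apply: (steps (R := fun a b => cle a b /\ forall s, w b ⊚ hx d a b s = hx e a b s ⊚ w a)).
  - by move=> {b s} a; split=> [|s]; [exact: cle_refl | rewrite !hx_id comp1f compf1].
  - move=> {s} a' b' c [ab Hab] [bc Hbc]; split=> [|s]; first exact: cle_trans ab bc.
    have E (z : NCobj T J) : hx z a' c s = hx z b' c (sle_of bc) ⊚ hx z a' b' (sle_of ab) by rewrite hx_comp.
    by rewrite !E compA Hbc -compA Hab compA.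
  - move=> i k k' kk'; split=> [|s']; first exact: mono.
    by rewrite !wE; exact: (cm_h (u i) k k' (sle_of kk')).
  - exact: of_sle s.
unshelve eexists (@NChom_ C T J d e w _ wh _); last exact: wE.
- move=> a; rewrite /w; case: (S a) => i [k E].
  apply: iso_comp; [apply: iso_comp|]; [|exact: (cm_iso (u i))|];
    by apply: hx_iso; apply: cle_of_eq.
(* The extreme vertices lie in one common piece, whose morphism commutes with the closing arrow. *)
- have wk : Fm T (w (cbot J)) ⊚ kx d (cbot J) (ctop J) = kx e (cbot J) (ctop J) ⊚ w (ctop J).
    by case: ends => i [k [k' [<- <-]]]; rewrite !wE; exact: (cm_k (u i)).
  move=> a b; rewrite (kx_bot_top d) (kx_bot_top e).
  rewrite !compA -Fm_comp wh Fm_comp -(compA (Fm T (hx e _ _ _))) wk.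
  by rewrite -!compA wh.
Qed.
End HomGluing.

(* Inverses of arrows of the diagram are included because [insC] below has no comparison
   in the reverse direction between identified vertices. *)
Definition linked (J : Chain) (z : NCobj T J) (a b : J) (w : Hom (vx z a) (vx z b)) : Prop :=
  is_iso w /\ ((exists h : cle a b, w = hx z a b (sle_of h)) \/
   (exists h : cle b a, hx z b a (sle_of h) ⊚ w = idm _)).

Section Linked.
Context (J : Chain) (z : NCobj T J).

Lemma linked_le (a b : J) (s : sle (cle a b)) : is_iso (hx z a b s) -> linked (hx z a b s).
Proof. by move=> h; split=> //; left; exists (of_sle s). Qed.

Lemma linked_eq (a b : J) : a = b -> exists w : Hom (vx z a) (vx z b), linked w.
Proof.
move=> ->; exists (hx z b b (srefl b)); apply: linked_le; exact: hx_iso (cle_refl b).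
Qed.

Lemma linked_inv (a b : J) (w : Hom (vx z a) (vx z b)) (w' : Hom (vx z b) (vx z a)) :
  w' ⊚ w = idm _ -> w ⊚ w' = idm _ -> linked w -> linked w'.
Proof.
move=> E1 E2 [wi Hw]; have w'i : is_iso w' by exists w.
split=> //; case: Hw => [[s Es]|[s Es]].
- by right; exists s; rewrite -Es.
- by left; exists s; rewrite (inv_unique Es E2).
Qed.

(** Where a linked arrow is an inverse, cancelling it against the arrow it inverts leaves composites
    of arrows of the diagram, and there is only one such arrow between two given vertices. *)
Lemma linked_square (a a' b b' : J) (w : Hom (vx z a) (vx z b)) (w' : Hom (vx z a') (vx z b'))
  (s : sle (cle a a')) (t : sle (cle b b')) :
  linked w -> linked w' -> w' ⊚ hx z a a' s = hx z b b' t ⊚ w.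
Proof.
move=> [wi [[r Er]|[r Er]]] [wi' [[r' Er']|[r' Er']]].
- by rewrite Er Er' !hx_comp.
- apply: (iso_monic (linv_iso wi' Er')).
  by rewrite Er compA Er' comp1f !hx_comp.
- apply: (iso_epic (linv_iso wi Er)).
  by rewrite -[RHS]compA (iso_linv wi Er) compf1 Er' !hx_comp.
- apply: (iso_monic (linv_iso wi' Er')).
  rewrite compA Er' comp1f compA hx_comp.
  apply: (iso_epic (linv_iso wi Er)).
  by rewrite -[RHS]compA (iso_linv wi Er) compf1 hx_comp.
Qed.

(** A square with an identity side. Linked arrows are thus unique and closed under composition
    whenever a linked composite exists. *)
Lemma linked_triangle (a b c : J) (w : Hom (vx z a) (vx z b)) (w' : Hom (vx z b) (vx z c))
  (w'' : Hom (vx z a) (vx z c)) :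
  linked w -> linked w' -> linked w'' -> w' ⊚ w = w''.
Proof.
move=> lw [wi' [[s E]|[s E]]] lw''.
- have := linked_square (srefl a) (sle_of s) lw lw''.
  by rewrite hx_id compf1 -E.
- have := linked_square (srefl a) (sle_of s) lw'' lw.
  rewrite hx_id compf1 => ->; rewrite compA.
  by rewrite (iso_linv wi' E) comp1f.
Qed.

Lemma linked_kx (a b c : J) (w : Hom (vx z a) (vx z b)) :
  linked w -> kx z c b ⊚ w = kx z c a.
Proof.
move=> [wi [[s ->]|[s E]]]; first exact: kx_hx.
by rewrite -(kx_hx _ _ (sle_of s)) -compA E compf1.
Qed.

Lemma linked_Tkx (a b c : J) (w : Hom (vx z a) (vx z b)) :
  linked w -> Fm T w ⊚ kx z a c = kx z b c.
Proof.
move=> [wi [[s ->]|[s E]]]; first exact: Thx_kx.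
rewrite -(Thx_kx _ _ (sle_of s)) compA -Fm_comp.
by rewrite (iso_linv wi E) Fm_id comp1f.
Qed.

(** Linked arrows commute with all arrows of the diagram, so any family of them is natural. *)
Lemma linked_NChom (K : Chain) (f g : Mono K J) :
  (forall k, exists w : Hom (vx z (f k)) (vx z (g k)), linked w) ->
  exists u : NChom (resD f z) (resD g z), forall k, linked (z := z) (cm u k : Hom (vx z (f k)) (vx z (g k))).
Proof.
move=> /(fun h k => constructive_indefinite_description _ (h k)) H.
have l k := svalP (H k).
unshelve eexists (@NChom_ C T K (resD f z) (resD g z) (fun k => sval (H k)) _ _ _); last exact: l.
- by move=> k; case: (l k).
- by move=> a b s /=; apply: linked_square.
- by move=> a b /=; rewrite linked_Tkx // linked_kx.
Qed.
End Linked.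

(* The chain [K] is inserted between the vertices [p] and [q] of [L].  Although its ends
   [k0] and [k1] are to be identified with [p] and [q], only [p <= k0] and [k1 <= q] are
   imposed, so that no inverse arrow is needed in the glued diagram. *)
Section Insertion.
Context (K L : Chain) (k0 k1 : K) (p q : L).
Hypotheses (k0_le : forall k, cle k0 k) (le_k1 : forall k, cle k k1)
  (pq : cle p q) (qNp : ~~ cle q p).

Definition insle (a b : K + L) : bool :=
  match a, b with
  | inl k, inl k' => cle k k'
  | inr l, inr l' => cle l l'
  | inl _, inr l => cle q l
  | inr l, inl _ => cle l p
  end.

Definition insC : Chain.
Proof.
refine (@Chain_ (K + L)%type insle _ _ (inr (cbot L)) (inr (ctop L)) _ _).
- by move=> [a|a]; exact: cle_refl.
- move=> [a|a] [b|b] [c|c] /= ab bc; try exact: cle_trans ab bc.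
  + by [].
  (* Passing from [K] to [L] and back would give [q <= p]. *)
  + by case/negP: qNp; exact: cle_trans ab bc.
  + by [].
  + exact: cle_trans ab (cle_trans pq bc).
- by move=> [a|a]; exact: cbot_le.
- by move=> [a|a]; exact: cle_top.
Defined.

Definition inlM : Mono K insC := @Mono_ K insC inl (fun _ _ h => h).
Definition inrM : Mono L insC := @Mono_ L insC inr (fun _ _ h => h).

Context (x : NCobj T K) (y : NCobj T L).
Context (al : Hom (vx y p) (vx x k0)) (be : Hom (vx x k1) (vx y q)).
Hypotheses
  (h_al : be ⊚ hx x k0 k1 (sle_of (k0_le k1)) ⊚ al = hx y p q (sle_of pq))
  (k_al : Fm T al ⊚ kx y p q ⊚ be = kx x k0 k1).

(** Arrows enter [K] through [p], [al], [k0] and leave it through [k1], [be], [q]. Closing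
    composites with one end in [L] are built from the closing arrow of [y]; within [K] that of [x]
    is kept, and [k_al] says that the two match. *)
Definition insD : NCdata T insC :=
  @NCdata_ C T insC
    (fun a => match a with inl k => vx x k | inr l => vx y l end)
    (fun a b => match a as a, b as b return sle (insle a b) ->
         Hom match a with inl k => vx x k | inr l => vx y l end
             match b with inl k => vx x k | inr l => vx y l end with
     | inl k, inl k' => hx x k k'
     | inr l, inr l' => hx y l l'
     | inl k, inr l => fun s => hx y q l s ⊚ be ⊚ hx x k k1 (sle_of (le_k1 k))
     | inr l, inl k => fun s => hx x k0 k (sle_of (k0_le k)) ⊚ al ⊚ hx y l p s
     end)
    (fun a b => match a as a, b as b return
         Hom match b with inl k => vx x k | inr l => vx y l end
             (T match a with inl k => vx x k | inr l => vx y l end) with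
     | inl k, inl k' => kx x k k'
     | inr l, inr l' => kx y l l'
     | inl k, inr l => Fm T (hx x k0 k (sle_of (k0_le k)) ⊚ al) ⊚ kx y p l
     | inr l, inl k => kx y l q ⊚ be ⊚ hx x k k1 (sle_of (le_k1 k))
     end).

Lemma insD_laws : NClaws insD.
Proof.
(* A path through the whole of [K] is the edge [p -> q]. *)
have H c d (f : Hom c _) (g : Hom _ d) :
    g ⊚ be ⊚ hx x k0 k1 (sle_of (k0_le k1)) ⊚ al ⊚ f = g ⊚ hx y p q (sle_of pq) ⊚ f.
  by rewrite -h_al !compA.
have Kb : Fm T al ⊚ (kx y p q ⊚ be) = kx x k0 k1 by rewrite compA.
(* [Kal] and [Kbe] trade the closing arrow of [x] for that of [y] at the two ends of [K]. *)
have Kal k : kx x k k0 ⊚ al = Fm T (hx x k0 k (sle_of (k0_le k))) ⊚ Fm T al ⊚ kx y p p.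
  rewrite -(kx_hx x k (sle_of (k0_le k1))) -(Thx_kx x _ (sle_of (k0_le k))) -k_al.
  by rewrite -!compA (compA be) h_al kx_hx.
have Kbe k : Fm T be ⊚ kx x k1 k = kx y q q ⊚ be ⊚ hx x k k1 (sle_of (le_k1 k)).
  rewrite -(Thx_kx x _ (sle_of (k0_le k1))) -(kx_hx x _ (sle_of (le_k1 k))) -k_al.
  by rewrite !compA -!Fm_comp h_al Thx_kx.
split.
- by move=> [a|a] s; exact: hx_id.
- move=> [a|a] [b|b] [c|c] s1 s2 s3; cbn -[sle].
  + exact: hx_comp.
  + by rewrite comp_hx_comp.
  + by case/negP: qNp; exact: cle_trans (of_sle (s1 : sle (cle q b))) (of_sle (s2 : sle (cle b p))).
  + by rewrite !compA hx_comp.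
  + by rewrite !compA hx_comp.
  + rewrite !compA comp_hx_comp H hx_comp.
    by rewrite hx_comp.
  + by rewrite -!compA hx_comp.
  + exact: hx_comp.
- move=> [a|a] [b|b] [b'|b'] s; cbn -[sle].
  + exact: kx_hx.
  + by rewrite !compA kx_hx Kal Fm_comp -(compA _ (kx y p p)) kx_hx.
  + rewrite !compA comp_kx_hx Fm_comp -!compA.
    rewrite (compA (kx y p q)) (compA (Fm T al)) Kb.
    by rewrite compA Thx_kx kx_hx.
  + by rewrite comp_kx_hx.
  + by rewrite comp_hx_comp.
  + rewrite !compA comp_hx_comp.
    by rewrite H !kx_hx.
  + by rewrite !compA kx_hx.
  + exact: kx_hx.
- move=> [a|a] [a'|a'] [b|b] s; cbn -[sle].
  + exact: Thx_kx.
  + by rewrite compA -Fm_comp compA hx_comp.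
  + rewrite !Fm_comp -compA Thx_kx -compA Kbe !compA Thx_kx.
    by [].
  + rewrite compA -Fm_comp !compA comp_hx_comp.
    rewrite -(compf1 (_ ⊚ al)) H compf1.
    by rewrite hx_comp Thx_kx.
  + rewrite !Fm_comp -!compA (compA _ (kx y a q)) Thx_kx.
    rewrite (compA (kx y p q)) (compA (Fm T al)) Kb.
    by rewrite compA Thx_kx kx_hx.
  + by rewrite !Fm_comp -!compA Thx_kx.
  + by rewrite !compA Thx_kx.
  + exact: Thx_kx.
Qed.

Definition insO : NCobj T insC := @NCobj_ C T insC insD insD_laws.
End Insertion.
End Diagrams.

Section InsertionLinks.
Context (C : Cat) (T : Functor C C) (K L : Chain) (k0 k1 : K) (p q : L).
Context (k0_le : forall k, cle k0 k) (le_k1 : forall k, cle k k1)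
  (pq : cle p q) (qNp : ~~ cle q p).
Context (x : NCobj T K) (y : NCobj T L).
Context (al : Hom (vx y p) (vx x k0)) (be : Hom (vx x k1) (vx y q)).
Context
  (h_al : be ⊚ hx x k0 k1 (sle_of (k0_le k1)) ⊚ al = hx y p q (sle_of pq))
  (k_al : Fm T al ⊚ kx y p q ⊚ be = kx x k0 k1).
Local Notation z := (insO le_k1 qNp h_al k_al).

(** In the inserted diagram [al] is the arrow [p -> k0] itself, so once invertible it identifies the
    two vertices. *)
Lemma linked_al : is_iso al -> linked (z := z) (a := inr p) (b := inl k0) al.
Proof.
move=> ai; split=> //; left; exists (cle_refl p); cbn -[sle].
by rewrite hx_id comp1f hx_id compf1.
Qed.

Lemma linked_be : is_iso be -> linked (z := z) (a := inl k1) (b := inr q) be.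
Proof.
move=> ai; split=> //; left; exists (cle_refl q); cbn -[sle].
by rewrite hx_id comp1f hx_id compf1.
Qed.
End InsertionLinks.

(** * Morphisms glued from two pieces *)

Section TwoPieces.
Context (C : Cat) (T : Functor C C) (J K L : Chain) (f : Mono K J) (g : Mono L J).
Hypotheses (f_inj : injective f) (g_inj : injective g).
Hypothesis cover : forall a, (exists k, f k = a) \/ (exists l, g l = a).
Hypothesis steps : forall R : J -> J -> Prop,
  (forall a, R a a) -> (forall a b c, R a b -> R b c -> R a c) ->
  (forall k k', cle k k' -> R (f k) (f k')) ->
  (forall l l', cle l l' -> R (g l) (g l')) -> forall a b, cle a b -> R a b.
Hypothesis ends : exists l l', g l = cbot J /\ g l' = ctop J.

Lemma hom_glue2 (d e : NCobj T J) (u : NChom (resD f d) (resD f e))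
    (v : NChom (resD g d) (resD g e)) :
  (forall k l (s : sle (cle (f k) (g l))), f k = g l ->
     cm v l ⊚ hx d _ _ s = hx e _ _ s ⊚ cm u k) ->
  exists w : NChom d e, (forall k, cm w (f k) = cm u k) /\ (forall l, cm w (g l) = cm v l).
Proof.
move=> agree.
pose Kb (b : bool) : Chain := if b then K else L.
pose fb b : Mono (Kb b) J := if b return Mono (Kb b) J then f else g.
pose ub b : NChom (resD (fb b) d) (resD (fb b) e) :=
  if b return NChom (resD (fb b) d) (resD (fb b) e) then u else v.
have [||||w wE] := @hom_glue C T J bool Kb fb _ _ _ d e ub.
- by move=> a; case: (cover a) => [[k E]|[l E]]; [exists true, k | exists false, l].
- move=> R R1 R2 R3; apply: steps => //.
  + exact: (R3 true).
  + exact: (R3 false).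
- by have [l [l' E]] := ends; exists false, l, l'.
- move=> [] k [] l s /= E.
  + have {}E := f_inj E; subst l.
    by rewrite !hx_id comp1f compf1.
  + exact: agree.
  (* Agreement in the opposite direction follows by cancelling the invertible arrow between the
     equal vertices. *)
  + have [r rs] : {t : unit | cle (f l) (g k)} by exists tt; rewrite E; exact: cle_refl.
    have A := agree _ _ (sle_of rs) (esym E).
    apply: (iso_epic (hx_iso d (sle_of rs) (cle_of_eq E))).
    rewrite -[LHS]compA hx_comp hx_id compf1 -[RHS]compA A compA hx_comp.
    by rewrite hx_id comp1f.
  + have {}E := g_inj E; subst l.
    by rewrite !hx_id comp1f compf1.
- by exists w; split; [exact: (wE true) | exact: (wE false)].
Qed.
End TwoPieces.

(** * Generation of the orders by consecutive steps *)

Lemma ord_steps (n : nat) (R : 'I_n.+1 -> 'I_n.+1 -> Prop) :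
  (forall a, R a a) -> (forall a b c, R a b -> R b c -> R a c) ->
  (forall a b : 'I_n.+1, b = a.+1 :> nat -> R a b) -> forall a b : 'I_n.+1, (a <= b)%N -> R a b.
Proof.
move=> R1 R2 R3 a b ab.
have [m Em] : {m | b = a + m :> nat} by exists (b - a); lia.
elim: m b Em {ab} => [|m IH] b Em.
  by have -> : a = b by apply: val_inj; rewrite /= Em addn0.
have bn := ltn_ord b.
have Hb : a + m < n.+1 by lia.
by apply: R2 (IH (Ordinal Hb) erefl) (R3 _ _ _) => /=; lia.
Qed.

(** A comparison from an unprimed to a primed vertex passes through the middle step [n < n']. *)
Lemma en_steps (n : nat) (R : enC n -> enC n -> Prop) :
  (forall a, R a a) -> (forall a b c, R a b -> R b c -> R a c) ->
  (forall a b : 'I_n.+1, b = a.+1 :> nat -> R (false, a) (false, b)) ->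
  (forall a b : 'I_n.+1, b = a.+1 :> nat -> R (true, b) (true, a)) ->
  (forall a : 'I_n.+1, a = n :> nat -> R (false, a) (true, a)) -> forall a b, cle a b -> R a b.
Proof.
move=> R1 R2 R3 R4 R5.
have F : forall a b : 'I_n.+1, (a <= b)%N -> R (false, a) (false, b).
  by apply: (@ord_steps n (fun a b => R (false, a) (false, b))) => // a b c; exact: R2.
have B : forall a b : 'I_n.+1, (a <= b)%N -> R (true, b) (true, a).
  by apply: (@ord_steps n (fun a b => R (true, b) (true, a))) => // a b c ab bc; exact: R2 bc ab.
move=> [[] a] [[] b] //=; rewrite /encle /= => ab; [exact: B | | exact: F].
apply: R2 (F _ ord_max _) (R2 _ _ _ (R5 ord_max erefl) (B _ _ _)); exact: leq_ord.
Qed.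

Lemma PBhom_eq (A B : Gph) (G : Gpd) (F : RawFun A G) (H : RawFun B G) (x y : PBobj F H)
  (f g : PBhom x y) : qa f = qa g -> qb f = qb g -> f = g.
Proof.
case: f g => [a b c] [a' b' c'] /= E E'; subst a' b'; f_equal; exact: proof_irrelevance.
Qed.

(** * The 2-Segal condition *)

Section NC2Segal.
Context (n i j : nat) (Hij : (i < j)%N) (Hjn : (j <= n)%N).
Local Notation K := (ordC (j - i)).
Local Notation L := (ordC (n - (j - i)).+1).
Local Notation f := (segM n i j).
Local Notation g := (cutM n i j).
Local Notation e := (edgM (j - i) 0 (j - i)).
Local Notation e' := (edgM (n - (j - i)).+1 i i.+1).

Lemma segM_inj : injective f.
Proof.
move=> a b /(congr1 val) /= E; apply: val_inj => /=; move: E (ltn_ord a) (ltn_ord b).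
rewrite /segf; lia.
Qed.

Lemma cutM_inj : injective g.
Proof.
move=> a b /(congr1 val) /= E; apply: val_inj => /=; move: E (ltn_ord a) (ltn_ord b).
rewrite /cutf; do 2 case: ifP => ?; lia.
Qed.

Lemma seg_cut_cover (a : 'I_n.+1) : (exists k, f k = a) \/ (exists l, g l = a).
Proof.
have an := ltn_ord a.
have [h|h] := boolP ((i <= a <= j)%N).
  left; exists (Ordinal (clamp_lt (a - i) (j - i))); apply: val_inj; rewrite /= /segf; lia.
right; exists (Ordinal (clamp_lt (if (a <= i)%N then nat_of_ord a else a - (j - i).-1) (n - (j - i)).+1)).
by apply: val_inj; rewrite /= /cutf; case: (leqP a i) => h1; case: ifP => h2; lia.
Qed.

Lemma seg_cut_steps (R : 'I_n.+1 -> 'I_n.+1 -> Prop) :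
  (forall k k' : 'I_(j - i).+1, (k <= k')%N -> R (f k) (f k')) ->
  (forall l l' : 'I_(n - (j - i)).+2, (l <= l')%N -> R (g l) (g l')) ->
  forall a b : 'I_n.+1, b = a.+1 :> nat -> R a b.
Proof.
move=> Rf Rg a b ab; have bn := ltn_ord b.
have [h|h] := boolP ((i <= a < j)%N).
  pose k := Ordinal (clamp_lt (a - i) (j - i)); pose k' := Ordinal (clamp_lt (b - i) (j - i)).
  have -> : a = f k by apply: val_inj; rewrite /= /segf; lia.
  have -> : b = f k' by apply: val_inj; rewrite /= /segf; lia.
  by apply: Rf => /=; lia.
pose c (a : nat) := if (a <= i)%N then a else a - (j - i).-1.
pose k := Ordinal (clamp_lt (c a) (n - (j - i)).+1).
pose k' := Ordinal (clamp_lt (c b) (n - (j - i)).+1).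
have -> : a = g k.
  by apply: val_inj; rewrite /= /cutf /c; case: (leqP a i) => h1; case: ifP => h2; lia.
have -> : b = g k'.
  by apply: val_inj; rewrite /= /cutf /c; case: (leqP b i) => h1; case: ifP => h2; lia.
by apply: Rg => /=; rewrite /c; case: ifP => h1; case: ifP => h2; lia.
Qed.

Lemma cutM_ends : g ord0 = ord0 /\ g ord_max = ord_max.
Proof.
split; apply: val_inj; rewrite /= /cutf //=; last by case: ifP => h; lia.
exact: min0n.
Qed.

(** Only [i] and [j] are shared: the ends of the segment, and the consecutive positions [i], [i.+1]
    of the cut. *)
Lemma seg_cut_overlap k l : f k = g l -> exists a, k = e a /\ l = e' a.
Proof.
move=> /(congr1 val) /= E; have kn := ltn_ord k; have ln := ltn_ord l.
move: E; rewrite /segf /cutf => E.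
have [l_i|l_i] := leqP l i; rewrite ?l_i ?(leqNgt l) ?l_i /= in E.
  exists ord0; split; apply: val_inj; rewrite /= /edgef; lia.
exists ord_max; split; apply: val_inj; rewrite /= /edgef; lia.
Qed.

Lemma edge_bot k : cle (e ord0) k.
Proof. by rewrite /= /edgef; lia. Qed.
Lemma edge_top k : cle k (e ord_max).
Proof. by have := ltn_ord k; rewrite /= /edgef; lia. Qed.
Lemma edge_le : cle (e' ord0) (e' ord_max).
Proof. by rewrite /= /edgef; lia. Qed.
Lemma edge_lt : ~~ cle (e' ord_max) (e' ord0).
Proof. by rewrite /= /edgef; lia. Qed.

(** A shared vertex is sent to the cut rather than to the segment, so that every [g l] goes to
    [inr l]. *)
Definition cut_sec (a : 'I_n.+1) : 'I_(j - i).+1 + 'I_(n - (j - i)).+2 :=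
  if (a <= i)%N then inr (Ordinal (clamp_lt a (n - (j - i)).+1))
  else if (a < j)%N then inl (Ordinal (clamp_lt (a - i) (j - i)))
  else inr (Ordinal (clamp_lt (a - (j - i).-1) (n - (j - i)).+1)).

Lemma cut_sec_cut l : cut_sec (g l) = inr l.
Proof.
have ln := ltn_ord l; rewrite /cut_sec /= /cutf.
by case: ifP => h1; [|case: ifP => h2]; [congr inr; apply: val_inj; move: h1 => /=| move: h1 h2 | congr inr; apply: val_inj; move: h1 h2 => /=]; case: ifP => h3; lia.
Qed.

Lemma cut_sec_seg k :
  cut_sec (f k) = inl k \/ exists a, k = e a /\ cut_sec (f k) = inr (e' a).
Proof.
have kn := ltn_ord k; rewrite /cut_sec /= /segf.
case: ifP => h1; [|case: ifP => h2].
- right; exists ord0; split; last congr inr; apply: val_inj; rewrite /= /edgef; lia.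
- left; congr inl; apply: val_inj => /=; lia.
- right; exists ord_max; split; last congr inr; apply: val_inj; rewrite /= /edgef; lia.
Qed.

Definition cut_secM : Mono (ordC n) (insC K edge_le edge_lt).
Proof.
refine (@Mono_ (ordC n) (insC K edge_le edge_lt) cut_sec _).
move=> a b /= ab; have an := ltn_ord a; have bn := ltn_ord b; rewrite /cut_sec.
by repeat case: ifP => ? /=; rewrite /edgef; lia.
Defined.

End NC2Segal.

(** The gluing data are the inverse of [phi] at the source and [phi] itself at the target;
    naturality of [phi] on the edge and on the closing arrow gives the two equations required by the
    insertion. *)
Lemma edge_glue (C : Cat) (T : Functor C C) (K L : Chain) (e : Mono (ordC 1) K) (e' : Mono (ordC 1) L)
  (x : NCobj T K) (y : NCobj T L) (phi : NChom (resD e x) (resD e' y))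
  (k0_le : forall k, cle (e ord0) k) (pq : cle (e' ord0) (e' ord_max)) :
  exists al : Hom (vx y (e' ord0)) (vx x (e ord0)),
  [/\ is_iso al, al ⊚ cm phi ord0 = idm _, cm phi ord0 ⊚ al = idm _,
    cm phi ord_max ⊚ hx x (e ord0) (e ord_max) (sle_of (k0_le (e ord_max))) ⊚ al
      = hx y (e' ord0) (e' ord_max) (sle_of pq)
    & Fm T al ⊚ kx y (e' ord0) (e' ord_max) ⊚ cm phi ord_max = kx x (e ord0) (e ord_max)].
Proof.
have [al [ali [E1 E2]]] := iso_inv (cm_iso phi ord0).
exists al; split=> //.
- have := cm_h phi ord0 ord_max (sle_of (leq0n _)) => /= ->.
  by rewrite -compA E2 compf1.
- have := cm_k phi ord0 ord_max => /=; rewrite -compA => <-.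
  by rewrite compA -Fm_comp E1 Fm_id comp1f.
Qed.

Lemma ord1_cases (a : 'I_2) : a = ord0 \/ a = ord_max.
Proof. by case: a => [[|[|a]] Ha] //; [left|right]; apply: val_inj. Qed.


(** The diagram is the insertion restricted along [s]. Its restrictions to [K] and [L] are compared
    with [x] and [y] by linked arrows, which exist because [s] moves a vertex at most to the copy it
    is identified with. *)
Lemma insertion_glue (C : Cat) (T : Functor C C) (J K L : Chain)
  (e : Mono (ordC 1) K) (e' : Mono (ordC 1) L)
  (k0_le : forall k, cle (e ord0) k) (le_k1 : forall k, cle k (e ord_max))
  (pq : cle (e' ord0) (e' ord_max)) (qNp : ~~ cle (e' ord_max) (e' ord0))
  (f : Mono K J) (g : Mono L J) (s : Mono J (insC K pq qNp)) :
  (forall a, f (e a) = g (e' a)) -> (forall l, s (g l) = inr l) ->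
  (forall k, s (f k) = inl k \/ exists a, k = e a /\ s (f k) = inr (e' a)) ->
  forall (x : NCobj T K) (y : NCobj T L) (phi : NChom (resD e x) (resD e' y)),
  exists (z : NCobj T J) (rho : NChom (resD f z) x) (tau : NChom (resD g z) y),
    forall a r, cm tau (e' a) ⊚ hx z (f (e a)) (g (e' a)) r = cm phi a ⊚ cm rho (e a).
Proof.
move=> fg sg sf x y phi.
have [al [ali E1 E2 h_al k_al]] := edge_glue phi k0_le pq.
pose z := insO le_k1 qNp h_al k_al.
have lal : linked (z := z) (a := inr _) (b := inl _) al := linked_al le_k1 qNp h_al k_al ali.
have lbe : linked (z := z) (a := inl _) (b := inr _) (cm phi ord_max) :=
  linked_be le_k1 qNp h_al k_al (cm_iso phi ord_max).
have lphi a : linked (z := z) (a := inl (e a)) (b := inr (e' a)) (cm phi a).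
  case: (ord1_cases a) => -> //.
  exact: (@linked_inv _ _ _ z (inr (e' ord0)) (inl (e ord0)) al (cm phi ord0) E2 E1 lal).
have lphi' a : exists w, linked (z := z) (a := inr (e' a)) (b := inl (e a)) w.
  have [w [wi [A B]]] := iso_inv (cm_iso phi a).
  by exists w; exact: (@linked_inv _ _ _ z (inl (e a)) (inr (e' a)) (cm phi a) w A B (lphi a)).
have [rho lrho] : exists u : NChom (resD f (resD s z)) x, forall k,
    linked (z := z) (a := s (f k)) (b := inl k) (cm u k).
  have [|u lu] := @linked_NChom C T _ z _ (compM s f) (inlM _ pq qNp).
    move=> k; case: (sf k) => [E|[a [-> E]]]; first exact: linked_eq.
    by have [w lw] := lphi' a; rewrite -E in w lw; exists w.
  (* The components are repackaged, since the restriction of the insertion to [K] is [x] only up to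
     the eta rule for records. *)
  by exists (@NChom_ C T _ (resD f (resD s z)) x (cm u) (cm_iso u) (cm_h u) (cm_k u)).
have [tau ltau] : exists u : NChom (resD g (resD s z)) y, forall k,
    linked (z := z) (a := s (g k)) (b := inr k) (cm u k).
  have [|u lu] := @linked_NChom C T _ z _ (compM s g) (inrM _ pq qNp).
    by move=> k; apply: linked_eq; exact: sg.
  by exists (@NChom_ C T _ (resD g (resD s z)) y (cm u) (cm_iso u) (cm_h u) (cm_k u)).
exists (resO s z), rho, tau => a r.
have [w lw] : exists w, linked (z := z) (a := s (f (e a))) (b := inr (e' a)) w.
  by apply: linked_eq; rewrite fg sg.
(* Both sides are linked arrows with the same ends, hence equal. *)
transitivity w; last by symmetry; exact: linked_triangle (lrho _) (lphi a) lw.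
apply: linked_triangle _ (ltau _) lw.
apply: linked_le; apply: hx_iso; apply: cle_of_eq.
by rewrite fg.
Qed.

Lemma NC_2Segal_holds (C : Cat) (T : Functor C C) : NC_2Segal T.
Proof.
move=> n i j H3 Hij Hjn; split.
- move=> d e; apply: inj_surj_bij.
  + move=> u v /= E; apply: hom_eq => a.
    case: (seg_cut_cover Hij Hjn a) => [[k <-]|[l <-]].
    * exact: (congr1 (fun w => cm (w : NChom _ _) k) (congr1 (fun w => qa w) E)).
    * exact: (congr1 (fun w => cm (w : NChom _ _) l) (congr1 (fun w => qb w) E)).
  + move=> [u v c].
    have [||||||w [wf wg]] := @hom_glue2 C T (ordC n) _ _ (segM n i j) (cutM n i j) _ _ _ _ _ d e u v.
    * exact: segM_inj.
    * exact: cutM_inj.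
    * exact: seg_cut_cover.
    * move=> R R1 R2 R3 R4; apply: ord_steps => //.
      exact: (seg_cut_steps Hij Hjn).
    * by exists ord0, ord_max; exact: cutM_ends.
    * move=> k l s /(seg_cut_overlap Hij Hjn) [a [Ek El]]; subst k l.
      exact: (f_equal (fun u => cm u a) c).
    * by exists w; apply: PBhom_eq; apply: hom_eq.
- move=> [x y phi].
  have [|||z [rho [tau E]]] := @insertion_glue C T (ordC n) _ _ _ _ (edge_bot Hij Hjn)
    (edge_top Hij Hjn) _ _ (segM n i j) (cutM n i j) (cut_secM Hij Hjn) _ _ _ x y phi.
  + exact: (seg_cut_eq Hij Hjn).
  + exact: cut_sec_cut.
  + exact: cut_sec_seg.
  exists z; refine (inhabits (@PBhom_ _ _ _ _ _ (X2Sfun T Hij Hjn z) (PBobj_ phi) rho tau _)).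
  by apply: hom_eq => a; exact: E.
Qed.

(** * Symmetric forms and the 1-Segal condition *)

Section NU.
Context (C : Cat) (D : Duality C) (T : Functor C C)
        (lam : forall x : C, Hom (dP D x) (T (dP D (T x))))
        (Hnat : lam_nat lam) (Hcoh : lam_coh lam).
Local Notation NU := (NUobj Hnat Hcoh).

Lemma Pm_Pm_Th (x y : C) (f : Hom x y) : Pm D (Pm D f) ⊚ dTh D x = dTh D y ⊚ f.
Proof. by rewrite /Pm dTh_nat. Qed.

Section Basics.
Context (n : nat).

Lemma usymF (y : NU n) k :
  Pm D (cm (upsi y) (true, k)) ⊚ dTh D (vx (ux y) (false, k)) = cm (upsi y) (false, k).
Proof. exact: usym y (false, k). Qed.

Lemma usymT (y : NU n) k :
  Pm D (cm (upsi y) (false, k)) ⊚ dTh D (vx (ux y) (true, k)) = cm (upsi y) (true, k).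
Proof. exact: usym y (true, k). Qed.

(** Applying [P] to the condition at [k] and using naturality and coherence of [Theta] gives the
    condition at [k']. *)
Lemma form_sym (z : NCobj T (enC n)) (psi : NChom z (PeD lam z)) :
  (forall k, Pm D (cm psi (true, k)) ⊚ dTh D (vx z (false, k)) = cm psi (false, k)) ->
  forall a, cm (NCcomp (PeH Hnat psi) (Theta Hnat Hcoh z)) a = cm psi a.
Proof.
move=> H [[] k]; last exact: H.
change (Pm D (cm psi (false, k)) ⊚ dTh D (vx z (true, k)) = cm psi (true, k)).
rewrite -H Pm_comp -compA Pm_Pm_Th compA.
by rewrite [X in X ⊚ _]dTh_coh comp1f.
Qed.

Definition form_obj (z : NCobj T (enC n)) (psi : NChom z (PeD lam z))
  (H : forall k, Pm D (cm psi (true, k)) ⊚ dTh D (vx z (false, k)) = cm psi (false, k)) : NU n :=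
  @NUobj_ C D T lam Hnat Hcoh n z psi (form_sym H).

(** By symmetry of the forms, the isometry equation at [k'] is the dual of the one at [k]. *)
Lemma isometry_unprimed (y z : NU n) (w : NChom (ux y) (ux z)) :
  (forall k, Pm D (cm w (true, k)) ⊚ cm (upsi z) (false, k) ⊚ cm w (false, k) = cm (upsi y) (false, k)) ->
  exists g : NUghom y z, uphi g = w.
Proof.
move=> H; unshelve eexists (@NUhom_ C D T lam n _ _ _ _ w _); last by [].
move=> [[] k]; last exact: H.
change (Pm D (cm w (false, k)) ⊚ cm (upsi z) (true, k) ⊚ cm w (true, k) = cm (upsi y) (true, k)).
rewrite -(usymT y) -H !Pm_comp -!compA Pm_Pm_Th.
congr (_ ⊚ _); rewrite compA; congr (_ ⊚ _); symmetry; exact: usymT.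
Qed.

(** Suited to the case where the primed components are defined by solving this very equation. *)
Lemma isometry_primed (y z : NU n) (w : NChom (ux y) (ux z)) :
  (forall k, Pm D (cm w (false, k)) ⊚ cm (upsi z) (true, k) ⊚ cm w (true, k) = cm (upsi y) (true, k)) ->
  exists g : NUghom y z, uphi g = w.
Proof.
move=> H; apply: isometry_unprimed => k.
rewrite -(usymF y) -H !Pm_comp -!compA Pm_Pm_Th.
congr (_ ⊚ _); rewrite compA; congr (_ ⊚ _); symmetry; exact: usymF.
Qed.

Lemma isometry_inv (y z : NU n) (g : NUghom y z) :
  {h : NUghom z y | (forall a, cm (uphi h) a ⊚ cm (uphi g) a = idm _) /\
                    (forall a, cm (uphi g) a ⊚ cm (uphi h) a = idm _)}.
Proof.
have [w [E1 E2]] := NChom_inv (uphi g).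
have [|h Eh] := constructive_indefinite_description _ (@isometry_unprimed z y w _); last first.
  by exists h; rewrite Eh.
move=> k; rewrite -(uiso g (false, k)) -!compA E2 compf1.
by rewrite compA -Pm_comp E2 Pm_id comp1f.
Qed.
End Basics.

(** As [a <= b <= a], the arrows between them are mutually inverse, so a gluing relation can be read
    in either direction. *)
Lemma swap_glued (J : Chain) (z : NCobj T J) (a b : J) (c d : C) (s : sle (cle a b)) (t : sle (cle b a))
  (tau : Hom (vx z b) d) (rho : Hom (vx z a) c) (phi : Hom c d) (phi' : Hom d c) :
  phi' ⊚ phi = idm _ -> tau ⊚ hx z a b s = phi ⊚ rho -> rho ⊚ hx z b a t = phi' ⊚ tau.
Proof.
move=> E H; rewrite -[tau]compf1 -(hx_id z (srefl b)).
have -> : hx z b b (srefl b) = hx z a b s ⊚ hx z b a t by rewrite hx_comp.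
by rewrite (compA tau) H !compA E comp1f.
Qed.

Section PulledBackForm.
Context (n m : nat) (al : Mono (ordC m) (ordC n)) (z : NCobj T (enC n)) (psi : NChom z (PeD lam z))
  (x : NU m) (rho : NChom (resD (ewM al) z) (ux x)).
Hypothesis psiE : forall a,
  cm psi (ewM al a) = cm (NCcomp (PeH Hnat rho) (NCcomp (upsi x) rho)) a.

(** [psiE] says that along [al] the form is [P(rho) psi_x rho]; such a pullback inherits symmetry
    from [x]. *)
Lemma pulled_form_sym l :
  Pm D (cm psi (true, al l)) ⊚ dTh D (vx z (false, al l)) = cm psi (false, al l).
Proof.
have HF : cm psi (false, al l) = Pm D (cm rho (true, l)) ⊚ (cm (upsi x) (false, l) ⊚ cm rho (false, l))
  := psiE (false, l).
have HT : cm psi (true, al l) = Pm D (cm rho (false, l)) ⊚ (cm (upsi x) (true, l) ⊚ cm rho (true, l))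
  := psiE (true, l).
rewrite HF HT !Pm_comp -!compA Pm_Pm_Th.
congr (_ ⊚ _); rewrite compA; congr (_ ⊚ _); exact: usymF.
Qed.

Lemma pulled_form_isometry
  (H : forall k, Pm D (cm psi (true, k)) ⊚ dTh D (vx z (false, k)) = cm psi (false, k)) :
  exists t : NUghom (resU al (form_obj H)) x, uphi t = rho.
Proof.
apply: isometry_unprimed => k.
have HF : cm psi (false, al k) = Pm D (cm rho (true, k)) ⊚ (cm (upsi x) (false, k) ⊚ cm rho (false, k))
  := psiE (false, k).
by rewrite -compA -HF.
Qed.
End PulledBackForm.

(* The edge [0 < 0'] *)
Definition e0M : Mono (ordC 1) (enC 0).
Proof.
refine (@Mono_ (ordC 1) (enC 0) (fun a => ((a != ord0 :> 'I_2), ord0)) _).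
by move=> [[|[|a]] Ha] [[|[|b]] Hb].
Defined.

Definition initM (m : nat) : Mono (ordC m) (ordC m.+1) :=
  @clampM m m.+1 id (fun _ _ h => h).

(** * Adding one edge in the middle of a symmetric diagram *)

Section Step.
Context (m : nat).
Local Notation f := (ewM (edgM m.+1 m m.+1)).
Local Notation g := (ewM (initM m)).
Local Notation e := (compM (ewM (ptM 1 0)) e0M).
Local Notation e' := (compM (ewM (ptM m m)) e0M).

Lemma step_f_inj : injective f.
Proof.
move=> [b p] [b' q] /= [-> E]; congr pair; apply: val_inj => /=.
move: E (ltn_ord p) (ltn_ord q); rewrite /edgef; lia.
Qed.

Lemma step_g_inj : injective g.
Proof.
move=> [b p] [b' q] /= [-> E]; congr pair; apply: val_inj => /=.
move: E (ltn_ord p) (ltn_ord q); rewrite /edgef; lia.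
Qed.

Lemma step_cover (a : enC m.+1) : (exists k, f k = a) \/ (exists l, g l = a).
Proof.
case: a => b p; have pm := ltn_ord p.
have [h|h] := leqP p m.
  right; exists (b, Ordinal (clamp_lt p m)); congr pair; apply: val_inj => /=; lia.
left; exists (b, ord_max); congr pair; apply: val_inj; rewrite /= /edgef; lia.
Qed.

Lemma step_steps (R : enC m.+1 -> enC m.+1 -> Prop) :
  (forall a, R a a) -> (forall a b c, R a b -> R b c -> R a c) ->
  (forall k k', cle k k' -> R (f k) (f k')) ->
  (forall l l', cle l l' -> R (g l) (g l')) -> forall a b, cle a b -> R a b.
Proof.
move=> R1 R2 Rf Rg.
have Eg b (p : 'I_m.+2) : (p <= m)%N -> (b, p) = g (b, Ordinal (clamp_lt p m)).
  by move=> h; congr pair; apply: val_inj => /=; lia.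
have Ef b (p : 'I_m.+2) : (m <= p)%N -> (b, p) = f (b, Ordinal (clamp_lt (p - m) 1)).
  by move=> h; have pm := ltn_ord p; congr pair; apply: val_inj; rewrite /= /edgef; lia.
apply: en_steps => //.
- move=> a b ab; have bm := ltn_ord b; have [h|h] := leqP b m.
  + by rewrite !Eg; try lia; apply: Rg; rewrite /= /encle /=; lia.
  + by rewrite !Ef; try lia; apply: Rf; rewrite /= /encle /=; lia.
- move=> a b ab; have bm := ltn_ord b; have [h|h] := leqP b m.
  + by rewrite !Eg; try lia; apply: Rg; rewrite /= /encle /=; lia.
  + by rewrite !Ef; try lia; apply: Rf; rewrite /= /encle /=; lia.
- by move=> a am; rewrite !Ef; try lia; apply: Rf.
Qed.

Lemma step_ends : exists l l', g l = cbot (enC m.+1) /\ g l' = ctop (enC m.+1).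
Proof.
by exists (false, ord0), (true, ord0); split; congr pair; apply: val_inj; exact: min0n.
Qed.

(** The pieces share exactly [m] and [m'], which form the edge [0 < 0'] of the new piece. *)
Lemma step_overlap k l : f k = g l -> exists a, k = e a /\ l = e' a.
Proof.
case: k l => [b p] [b' q] /= [-> E]; move: E (ltn_ord p) (ltn_ord q); rewrite /edgef => E pm qm.
exists (if b' then ord_max else ord0).
by case: b'; split; congr pair; apply: val_inj; rewrite /= /ptf; lia.
Qed.

Lemma step_pt b : f (ewM (ptM 1 0) b) = g (ewM (ptM m m) b).
Proof. congr pair; apply: val_inj; rewrite /= /edgef /ptf; lia. Qed.

Lemma step_eq a : f (e a) = g (e' a).
Proof. congr pair; apply: val_inj; rewrite /= /edgef /ptf; lia. Qed.

Lemma step_bot (k : enC 1) : cle (e ord0) k.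
Proof. by case: k => [[] k]; rewrite //= /encle /= /ptf min0n. Qed.
Lemma step_top (k : enC 1) : cle k (e ord_max).
Proof. by case: k => [[] k]; rewrite //= /encle /= /ptf min0n. Qed.
Lemma step_le : cle (e' ord0) (e' ord_max).
Proof. by []. Qed.
Lemma step_lt : ~~ cle (e' ord_max) (e' ord0).
Proof. by []. Qed.

Definition step_sec (a : enC m.+1) : enC 1 + enC m :=
  if (a.2 <= m)%N then inr (a.1, Ordinal (clamp_lt a.2 m)) else inl (a.1, ord_max).

Lemma step_sec_g l : step_sec (g l) = inr l.
Proof.
case: l => b q; have qm := ltn_ord q; rewrite /step_sec /=.
by case: ifP => h; [congr (inr (_, _)); apply: val_inj => /= | exfalso]; lia.
Qed.

Lemma step_sec_f k : step_sec (f k) = inl k \/ exists a, k = e a /\ step_sec (f k) = inr (e' a).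
Proof.
case: k => b p; have pm := ltn_ord p; rewrite /step_sec /= /edgef.
case: ifP => h.
  right; exists (if b then ord_max else ord0).
  by case: b {h} (h); split; [|congr inr| |congr inr]; congr pair; apply: val_inj; rewrite /= /ptf; lia.
left; congr (inl (_, _)); apply: val_inj => /=; lia.
Qed.

Definition step_secM : Mono (enC m.+1) (insC (enC 1) step_le step_lt).
Proof.
refine (@Mono_ (enC m.+1) (insC (enC 1) step_le step_lt) step_sec _).
move=> [b p] [b' q]; rewrite /= /encle /step_sec /=.
have pm := ltn_ord p; have qm := ltn_ord q.
by case: b; case: b'; case: ifP => ? /=; case: ifP => ? //=; rewrite /encle /= /ptf //=; lia.
Defined.

(** The underlying diagram is an insertion. The forms of [x] and [y], pulled back to the two pieces,
    agree on [m] and [m'] because [phi] is an isometry, so they glue. *)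
Lemma NU_step (y : NU m) (x : NU 1) (phi : NUghom (resU (ptM m m) y) (resU (ptM 1 0) x)) :
  exists (z : NU m.+1) (tau : NUghom (resU (initM m) z) y)
    (rho : NUghom (resU (edgM m.+1 m m.+1) z) x),
  forall a s, cm (uphi rho) (ewM (ptM 1 0) a)
      ⊚ hx (ux z) (g (ewM (ptM m m) a)) (f (ewM (ptM 1 0) a)) s
    = cm (uphi phi) a ⊚ cm (uphi tau) (ewM (ptM m m) a).
Proof.
have [phi' [P1 P2]] := isometry_inv phi.
(* The insertion wants a comparison from the inserted piece to the host, hence the inverse of
   [phi]. *)
pose ph : NChom (resD e (ux x)) (resD e' (ux y)) := resH e0M (uphi phi').
have [|||z [rho [tau E]]] := @insertion_glue C T (enC m.+1) (enC 1) (enC m) e e' step_bot step_top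
    step_le step_lt f g step_secM _ _ _ (ux x) (ux y) ph.
- exact: step_eq.
- exact: step_sec_g.
- exact: step_sec_f.
have {}E (a : enC 0) s : cm rho (ewM (ptM 1 0) a) ⊚ hx z (g (ewM (ptM m m) a)) (f (ewM (ptM 1 0) a)) s
    = cm (uphi phi) a ⊚ cm tau (ewM (ptM m m) a).
  have [c Ec] : exists c, a = e0M c.
    exists (if a.1 then ord_max else ord0); case: a {s} => [[] k]; rewrite /= (ord1 k) //.
  subst a.
  have r : cle (f (e c)) (g (e' c)) by apply: cle_of_eq; exact: step_eq.
  exact: swap_glued (P2 (e0M c)) (E c (sle_of r)).
pose u : NChom (resD f z) (resD f (PeD lam z)) :=
  NCcomp (PeH Hnat rho) (NCcomp (upsi x) rho).
pose v : NChom (resD g z) (resD g (PeD lam z)) :=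
  NCcomp (PeH Hnat tau) (NCcomp (upsi y) tau).
have [|psi [psif psig]] := hom_glue2 step_f_inj step_g_inj step_cover step_steps step_ends
   (d := z) (e := PeO Hnat z) (u := u) (v := v).
  move=> k l s /step_overlap [c [Ek El]]; subst k l.
  set a := e0M c.
  have swap b (r : sle (cle (f (ewM (ptM 1 0) b)) (g (ewM (ptM m m) b)))) :
      cm tau (ewM (ptM m m) b) ⊚ hx z _ _ r = cm (uphi phi') b ⊚ cm rho (ewM (ptM 1 0) b).
    exact: swap_glued (P1 b) (E b (sle_of (cle_of_eq (esym (step_pt b))))).
  pose ka := ewM (ptM 1 0) (e0M c); pose la := ewM (ptM m m) (e0M c).
  change (Pm D (cm tau (erev la)) ⊚ (cm (upsi y) la ⊚ cm tau la) ⊚ hx z (f ka) (g la) s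
    = Pm D (hx z (g (erev la)) (f (erev ka)) (srev s))
      ⊚ (Pm D (cm rho (erev ka)) ⊚ (cm (upsi x) ka ⊚ cm rho ka))).
  (* The isometry equation of [phi] with one factor moved across. *)
  have iso : cm (upsi y) la ⊚ cm (uphi phi') (e0M c)
      = Pm D (cm (uphi phi) (erev (e0M c))) ⊚ cm (upsi x) ka.
    have H : Pm D (cm (uphi phi) (erev (e0M c))) ⊚ cm (upsi x) ka ⊚ cm (uphi phi) (e0M c) = cm (upsi y) la
      := uiso phi (e0M c).
    by rewrite -H -!compA P2 compf1.
  have sw : cm tau la ⊚ hx z (f ka) (g la) s = cm (uphi phi') (e0M c) ⊚ cm rho ka := swap (e0M c) s.
  have Er : cm rho (erev ka) ⊚ hx z (g (erev la)) (f (erev ka)) (srev s)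
      = cm (uphi phi) (erev (e0M c)) ⊚ cm tau (erev la) := E (erev (e0M c)) (srev s).
  rewrite -!compA sw (compA (cm (upsi y) la)) iso.
  rewrite (compA (Pm D (hx z _ _ _))) -Pm_comp Er Pm_comp.
  by rewrite !compA.
have psi_sym k : Pm D (cm psi (true, k)) ⊚ dTh D (vx z (false, k)) = cm psi (false, k).
  have [[[b l] [_ <-]]|[[b l] [_ <-]]] := step_cover (false, k).
  - exact: (@pulled_form_sym m.+1 1 (edgM m.+1 m m.+1) z psi x rho psif).
  - exact: (@pulled_form_sym m.+1 m (initM m) z psi y tau psig).
have [tau' Et] := @pulled_form_isometry m.+1 m (initM m) z psi y tau psig psi_sym.
have [rho' Er] := @pulled_form_isometry m.+1 1 (edgM m.+1 m m.+1) z psi x rho psif psi_sym.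
exists (form_obj psi_sym), tau', rho' => a s; rewrite Et Er; exact: E.
Qed.
End Step.
End NU.

Lemma IPhom_eq (Y1 : Gph) (Y0 : Gpd) (s t : RawFun Y1 Y0) (n : nat) (x y : IPobj s t n)
  (f g : IPhom x y) : (forall k, ipq f k = ipq g k) -> f = g.
Proof.
case: f g => [a c] [a' c'] /= E.
have {}E : a = a' by apply: functional_extensionality_dep.
subst a'; f_equal; exact: proof_irrelevance.
Qed.

Section NU1Segal.
Context (C : Cat) (D : Duality C) (T : Functor C C)
        (lam : forall x : C, Hom (dP D x) (T (dP D (T x))))
        (Hnat : lam_nat lam) (Hcoh : lam_coh lam).
Local Notation NU := (NUobj Hnat Hcoh).

(** [al] is the identity only pointwise, so the comparison is by arrows of the diagram; they are
    recorded for later computation. *)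
Lemma resU_id (m : nat) (al : Mono (ordC m) (ordC m)) (y : NU m) :
  (forall a, al a = a) ->
  {g : NUghom (resU al y) y | forall a s, cm (uphi g) a = hx (ux y) (ewM al a) a s}.
Proof.
move=> H; have H' (a : enC m) : ewM al a = (@Mono_ (enC m) (enC m) id (fun _ _ h => h)) a.
  by case: a => b k /=; rewrite H.
pose w := reidx (ux y) H'.
unshelve eexists (@NUhom_ C D T lam m _ _ _ _
  (@NChom_ C T (enC m) (resD (ewM al) (ux y)) (ux y) (cm w) (cm_iso w) (cm_h w) (cm_k w)) _);
  last by [].
move=> a /=.
rewrite -compA (cm_h (upsi y)) compA /= -Pm_comp hx_comp hx_id.
by rewrite Pm_id comp1f.
Qed.

(** * Covering the subdivided chain by doubled edges *)

Section Edges.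
Context (n : nat).
Local Notation f := (fun k : 'I_n => ewM (edgM n k k.+1)).

Lemma edges_at (k : 'I_n) (b : bool) (p : 'I_n.+1) : (k <= p <= k.+1)%N ->
  (b, p) = f k (b, Ordinal (clamp_lt (p - k) 1)).
Proof.
move=> h; have pn := ltn_ord p; congr pair; apply: val_inj; rewrite /= /edgef; lia.
Qed.

Lemma edges_cover (n0 : (0 < n)%N) (a : enC n) : exists k l, f k l = a.
Proof.
case: a => b p; have pn := ltn_ord p.
have kn : (if p == 0 :> nat then 0 else p.-1) < n by case: ifP => ?; lia.
exists (Ordinal kn), (b, Ordinal (clamp_lt (p - Ordinal kn) 1)).
by rewrite -edges_at //=; case: ifP => ?; lia.
Qed.

Lemma edges_steps (n0 : (0 < n)%N) (R : enC n -> enC n -> Prop) :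
  (forall a, R a a) -> (forall a b c, R a b -> R b c -> R a c) ->
  (forall k l l', cle l l' -> R (f k l) (f k l')) -> forall a b, cle a b -> R a b.
Proof.
move=> R1 R2 Rf; apply: en_steps => //.
- move=> a b ab; have bn := ltn_ord b; have an : a < n by lia.
  rewrite (@edges_at (Ordinal an) false a) ?(@edges_at (Ordinal an) false b); try by move=> /=; lia.
  by apply: (Rf (Ordinal an)); rewrite /= /encle /=; lia.
- move=> a b ab; have bn := ltn_ord b; have an : a < n by lia.
  rewrite (@edges_at (Ordinal an) true a) ?(@edges_at (Ordinal an) true b); try by move=> /=; lia.
  by apply: (Rf (Ordinal an)); rewrite /= /encle /=; lia.
(* The middle step [n < n'] lies in the last doubled edge. *)
- move=> a an'; have an : n.-1 < n by lia.
  rewrite (@edges_at (Ordinal an) false a) ?(@edges_at (Ordinal an) true a); try by move=> /=; lia.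
  by apply: (Rf (Ordinal an)).
Qed.

Lemma edges_ends (n0 : (0 < n)%N) : exists k l l', f k l = cbot (enC n) /\ f k l' = ctop (enC n).
Proof.
(* The closing arrow goes from [0'] to [0], both in the first doubled edge. *)
exists (Ordinal n0), (false, ord0), (true, ord0).
by split; congr pair; apply: val_inj; rewrite /= /edgef; lia.
Qed.

Lemma edges_overlap k l a b : f k a = f l b ->
  [\/ k = l /\ a = b,
      l = k.+1 :> nat /\ exists c, a = ewM (ptM 1 1) c /\ b = ewM (ptM 1 0) c
    | k = l.+1 :> nat /\ exists c, a = ewM (ptM 1 0) c /\ b = ewM (ptM 1 1) c].
Proof.
case: a b => [b p] [b' q] /= [-> E].
have kn := ltn_ord k; have ln := ltn_ord l; have pn := ltn_ord p; have qn := ltn_ord q.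
rewrite /edgef in E.
have [kl|[kl|kl]] : k = l :> nat \/ l = k.+1 :> nat \/ k = l.+1 :> nat by lia.
- constructor 1; split; [exact: val_inj | congr pair; apply: val_inj => /=; lia].
- constructor 2; split=> //; exists (b', ord0).
  by split; congr pair; apply: val_inj; rewrite /= /ptf; lia.
- constructor 3; split=> //; exists (b', ord0).
  by split; congr pair; apply: val_inj; rewrite /= /ptf; lia.
Qed.
End Edges.

Lemma Y1S_full (n : nat) (n0 : (0 < n)%N) (y z : NUgpd Hnat Hcoh n) (u : IPhom (Y1Sobj y) (Y1Sobj z)) :
  exists w : NUghom y z, forall k : 'I_n, resUH (edgM n k k.+1) w = ipq u k.
Proof.
pose v (k : 'I_n) : NChom (resD (ewM (edgM n k k.+1)) (ux y)) (resD (ewM (edgM n k k.+1)) (ux z)) := uphi (ipq u k).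
have agree (k k' : 'I_n) (kk' : k' = k.+1 :> nat) (a : enC 0)
   (s : sle (cle (ewM (edgM n k k.+1) (ewM (ptM 1 1) a)) (ewM (edgM n k' k'.+1) (ewM (ptM 1 0) a)))) :
  cm (v k') (ewM (ptM 1 0) a) ⊚ hx (ux y) (ewM (edgM n k k.+1) (ewM (ptM 1 1) a)) (ewM (edgM n k' k'.+1) (ewM (ptM 1 0) a)) s
  = hx (ux z) _ _ s ⊚ cm (v k) (ewM (ptM 1 1) a).
  exact: (congr1 (fun w => cm (uphi (w : NUghom _ _)) a) (ipcomm u kk')).
have [||||w wE] := @hom_glue C T (enC n) 'I_n (fun _ => enC 1) (fun k => ewM (edgM n k k.+1)) _ _ _ (ux y) (ux z) v.
- exact: edges_cover.
- exact: edges_steps.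
- exact: edges_ends.
- move=> k a l b s E.
  have [[kl ab]|[kl [c [ak bk]]]|[kl [c [ak bk]]]] := edges_overlap E.
  + by subst l b; rewrite !hx_id comp1f compf1.
  + by subst a b; exact: agree.
  + subst a b; have t : cle (ewM (edgM n l l.+1) (ewM (ptM 1 1) c)) (ewM (edgM n k k.+1) (ewM (ptM 1 0) c)).
      exact: cle_of_eq (esym E).
    have := agree _ _ kl c (sle_of t) => H.
    apply: (iso_epic (hx_iso (ux y) (sle_of t) (cle_of_eq E))).
    rewrite -[LHS]compA hx_comp hx_id compf1 -[RHS]compA H compA hx_comp.
    by rewrite hx_id comp1f.
- have [|g Eg] := @isometry_unprimed C D T lam Hnat Hcoh n y z w.
    move=> p; have [k [[b l] E]] := edges_cover n0 (false, p).
    case: E => Eb Ep; subst b p.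
    have HF : cm w (false, edgM n k k.+1 l) = cm (v k) (false, l) := wE k (false, l).
    have HT : cm w (true, edgM n k k.+1 l) = cm (v k) (true, l) := wE k (true, l).
    rewrite HF HT; exact: (uiso (ipq u k) (false, l)).
  exists g => k; apply: NUhom_eq; apply: hom_eq => a.
  by rewrite /= Eg; exact: wE.
Qed.

(** Induction on the number of edges glued so far: [z] realizes the edges [0, ..., m] of [b], and
    [rho] identifies each of them. *)
Lemma Y1S_ess (n : nat) (b : IPobj (resUF Hnat Hcoh (ptM 1 0)) (resUF Hnat Hcoh (ptM 1 1)) n)
    (m : nat) : (m < n)%N ->
  exists (z : NU m.+1)
    (rho : forall k : 'I_n, (k <= m)%N -> NUghom (resU (edgM m.+1 k k.+1) z) (ipy b k)),
  forall (k k' : 'I_n) (e : k' = k.+1 :> nat) (h : (k <= m)%N) (h' : (k' <= m)%N) (a : enC 0) s,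
    cm (uphi (rho k' h')) (ewM (ptM 1 0) a)
      ⊚ hx (ux z) (ewM (edgM m.+1 k k.+1) (ewM (ptM 1 1) a))
                  (ewM (edgM m.+1 k' k'.+1) (ewM (ptM 1 0) a)) s
    = cm (uphi (ipph b e)) a ⊚ cm (uphi (rho k h)) (ewM (ptM 1 1) a).
Proof.
elim: m => [|m IH] mn.
  exists (ipy b (Ordinal mn)).
  have R (k : 'I_n) : (k <= 0)%N -> NUghom (resU (edgM 1 k k.+1) (ipy b (Ordinal mn))) (ipy b k).
    move=> k0; have Ek : Ordinal mn = k by apply: val_inj => /=; lia.
    subst k.
    suff H : forall a, edgM 1 0 1 a = a by exact: (sval (resU_id (ipy b (Ordinal mn)) H)).
    move=> a; have an := ltn_ord a.
    by apply: val_inj; rewrite /= /edgef; lia.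
  by exists R => k k' e h h'; exfalso; lia.
have [|z [rho E]] := IH; first exact: ltnW.
pose K := Ordinal (ltnW mn); pose K' := Ordinal mn.
have Ept : forall a, ptM m.+1 m.+1 a = compM (edgM m.+1 m m.+1) (ptM 1 1) a.
  by move=> a; apply: val_inj; rewrite /= /edgef /ptf; lia.
(* The end of the last edge of [z] is matched with the start of the next edge through [rho] and the
   isomorphism given by [b]. *)
pose phi : NUghom (resU (ptM m.+1 m.+1) z) (resU (ptM 1 0) (ipy b K')) :=
  NUcomp (ipph b (erefl : K' = K.+1 :> nat)) 
    (NUcomp (resUH (ptM 1 1) (rho K (leqnn m))) (reidxU z Ept)).
have [z' [tau [sig F]]] := NU_step phi.
have Eed (k : 'I_n) (h : (k <= m)%N) : forall a, edgM m.+2 k k.+1 a = compM (initM m.+1) (edgM m.+1 k k.+1) a.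
  by move=> a; have an := ltn_ord a; apply: val_inj; rewrite /= /edgef; lia.
(* Old edges are compared by [rho] after [tau], the new one by [sig]. Both formulas are kept in the
   type because the definition goes by cases on [k]. *)
have rho' (k : 'I_n) (h : (k <= m.+1)%N) : {r : NUghom (resU (edgM m.+2 k k.+1) z') (ipy b k) |
    (forall (h' : (k <= m)%N), r = NUcomp (rho k h') (NUcomp (resUH (edgM m.+1 k k.+1) tau) (reidxU z' (Eed k h')))) /\
    (forall (Ek : K' = k), r = match Ek in _ = k return NUghom (resU (edgM m.+2 k k.+1) z') (ipy b k) with
       erefl => sig end)}.
  have [h'|h'] : {(k <= m)%N} + {~~ (k <= m)%N} by case: (k <= m)%N; [left | right].
    eexists; split; last by move=> Ek; exfalso; subst k; rewrite /= ltnn in h'.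
    move=> h''; rewrite (bool_irrelevance h'' h'); reflexivity.
  have Ek : K' = k by apply: val_inj => /=; lia.
  subst k; exists sig; split; first by move=> h''; exfalso; lia.
  by move=> Ek; rewrite (proof_irrelevance _ Ek erefl).
exists z', (fun k h => sval (rho' k h)) => k k' e h h' a s.
have hk : (k <= m)%N by lia.
have [Rk _] := svalP (rho' k h); have [Rk' Sk'] := svalP (rho' k' h').
have [hk'|hk'] : {(k' <= m)%N} + {~~ (k' <= m)%N} by case: (k' <= m)%N; [left | right].
  rewrite (Rk hk) (Rk' hk').
  have r : cle (ewM (edgM m.+1 k k.+1) (ewM (ptM 1 1) a)) (ewM (edgM m.+1 k' k'.+1) (ewM (ptM 1 0) a)).
    by apply: cle_of_eq; congr pair; apply: val_inj; rewrite /= /edgef /ptf; lia.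
  have Ez := E k k' e hk hk' a (sle_of r).
  have Et := cm_h (uphi tau) _ _ (sle_of r).
  cbn -[sle] in Ez, Et |- *.
  rewrite -!compA hx_comp [RHS]compA -Ez -!compA (compA (hx (ux z) _ _ _)) -Et.
  by rewrite -!compA hx_comp.
have Ek' : K' = k' by apply: val_inj => /=; lia.
subst k'. rewrite (Sk' erefl) (Rk hk).
have r : cle (ewM (initM m.+1) (ewM (ptM m.+1 m.+1) a)) (ewM (edgM m.+2 m.+1 m.+2) (ewM (ptM 1 0) a)).
  by apply: cle_of_eq; congr pair; apply: val_inj; rewrite /= /edgef /ptf; lia.
have Ek : K = k by apply: val_inj; rewrite /= in e *; lia.
subst k.
rewrite (bool_irrelevance hk (leqnn m)) (proof_irrelevance _ e erefl).
have t : cle (ewM (ptM m.+1 m.+1) a) (ewM (edgM m.+1 m m.+1) (ewM (ptM 1 1) a)).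
  by apply: cle_of_eq; congr pair; apply: val_inj; rewrite /= /edgef /ptf; lia.
have t' : cle (ewM (edgM m.+2 m m.+1) (ewM (ptM 1 1) a)) (ewM (initM m.+1) (ewM (ptM m.+1 m.+1) a)).
  by apply: cle_of_eq; congr pair; apply: val_inj; rewrite /= /edgef /ptf; lia.
have Fz := F a (sle_of r).
have Et := cm_h (uphi tau) _ _ (sle_of t).
have -> : hx (ux z') (ewM (edgM m.+2 K K.+1) (ewM (ptM 1 1) a))
     (ewM (edgM m.+2 K' K'.+1) (ewM (ptM 1 0) a)) s
   = hx (ux z') _ _ (sle_of r) ⊚ hx (ux z') _ _ (sle_of t') by rewrite hx_comp.
rewrite compA; cbn -[sle] in Fz, Et |- *.
rewrite Fz -!compA; congr (_ ⊚ _); congr (_ ⊚ _).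
by rewrite compA -Et -compA hx_comp.
Qed.

Lemma NU_1Segal_holds : NU_1Segal Hnat Hcoh.
Proof.
move=> n H2; have n0 : (0 < n)%N by lia.
split.
- move=> y z; apply: inj_surj_bij.
  + move=> u v /= E; apply: NUhom_eq; apply: hom_eq => a.
    have [k [l <-]] := edges_cover n0 a.
    exact: (congr1 (fun w => cm (uphi (w : NUghom _ _)) l) (congr1 (fun w => ipq w k) E)).
  + move=> u; have [w wE] := Y1S_full n0 u.
    by exists w; apply: IPhom_eq.
- case: n n0 {H2} => // n _ b.
  have [z [rho E]] := Y1S_ess b (ltnSn n).
  exists z.
  refine (inhabits (@IPhom_ _ _ _ _ _ (Y1Sobj z) b (fun k => rho k (leq_ord k)) _)).
  move=> k k' e; apply: NUhom_eq; apply: hom_eq => a.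
  exact: E.
Qed.
End NU1Segal.

(** * The relative 2-Segal condition *)

Definition opC (K : Chain) : Chain :=
  @Chain_ (cT K) (fun a b => cle b a) (@cle_refl K)
    (fun a b c ab bc => cle_trans bc ab) (ctop K) (cbot K) (@cle_top K) (@cbot_le K).

(** * Dual diagrams on opposite chains *)

Section DualDiagram.
Context (C : Cat) (D : Duality C) (T : Functor C C)
        (lam : forall x : C, Hom (dP D x) (T (dP D (T x))))
        (Hnat : lam_nat lam) (Hcoh : lam_coh lam).

(** The counterpart of [PeD] for a chain without a reversal, hence indexed by the opposite chain. *)
Definition dualD (K : Chain) (d : NCdata T K) : NCdata T (opC K) :=
  @NCdata_ C T (opC K) (fun a => dP D (vx d a))
    (fun a b s => Pm D (hx d b a s))
    (fun a b => Fm T (Pm D (kx d b a)) ⊚ lam (vx d b)).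

Lemma dualD_laws (K : Chain) (x : NCobj T K) : NClaws (dualD x).
Proof.
split => /=.
- by move=> a s; rewrite [hx _ _ _ _]hx_id Pm_id.
- by move=> a b c s1 s2 s3; rewrite -Pm_comp [_ ⊚ _]hx_comp.
- move=> a b b' s; rewrite -compA Hnat compA -Fm_comp -Pm_comp.
  by rewrite Thx_kx.
- move=> a a' b s; rewrite compA -Fm_comp -Pm_comp.
  by rewrite kx_hx.
Qed.

Definition dualO (K : Chain) (x : NCobj T K) : NCobj T (opC K) :=
  @NCobj_ C T (opC K) (dualD x) (dualD_laws x).

Definition dualH (K : Chain) (d e : NCdata T K) (u : NChom d e) : NChom (dualD e) (dualD d).
Proof.
refine (@NChom_ C T (opC K) (dualD e) (dualD d) (fun a => Pm D (cm u a)) _ _ _).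
- by move=> a; apply: Pm_iso; exact: cm_iso.
- by move=> a b s /=; rewrite -!Pm_comp cm_h.
- move=> a b /=.
  by rewrite compA -Fm_comp -Pm_comp -cm_k Pm_comp Fm_comp -compA -Hnat compA.
Defined.

(* [opC] is an involution only up to the eta rule for records. *)
Definition ddual (K : Chain) (d : NCdata T K) : NCdata T K :=
  @NCdata_ C T K (vx (dualD (dualD d))) (hx (dualD (dualD d))) (kx (dualD (dualD d))).

Definition ThetaD (K : Chain) (d : NCdata T K) : NChom d (ddual d).
Proof.
refine (@NChom_ C T K d (ddual d) (fun a => dTh D (vx d a)) _ _ _).
- by move=> a; exact: dTh_iso.
- by move=> a b s; exact: dTh_nat.
- move=> a b /=.
  rewrite Pm_comp Fm_comp -(compA (Fm T (Pm D (lam _)))) -Hnat -!compA -dTh_nat.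
  by rewrite (compA (lam _)) compA Hcoh.
Defined.
End DualDiagram.

Lemma agree_sym (C : Cat) (T : Functor C C) (J : Chain) (d e : NCobj T J) (a b : J) (E : a = b)
  (u : Hom (vx d a) (vx e a)) (v : Hom (vx d b) (vx e b)) (s : sle (cle a b)) (t : sle (cle b a)) :
  v ⊚ hx d a b s = hx e a b s ⊚ u -> u ⊚ hx d b a t = hx e b a t ⊚ v.
Proof. by subst b; rewrite !hx_id !comp1f !compf1. Qed.

(** An intermediate stage between the cut and the full chain: the segment is filled in on the
    unprimed side only. *)
Definition mixle (n c : nat) (a b : 'I_n.+1 + 'I_c.+1) : bool :=
  match a, b with
  | inl a, inl b => a <= b
  | inl _, inr _ => true
  | inr _, inl _ => false
  | inr a, inr b => b <= a
  end.

(* [{0 < ... < n < c' < ... < 0'}] *)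
Definition mixC (n c : nat) : Chain.
Proof.
refine (@Chain_ ('I_n.+1 + 'I_c.+1)%type (@mixle n c) _ _ (inl ord0) (inr ord0) _ _).
- by move=> [a|a] /=.
- by move=> [a|a] [b|b] [d|d] //= ab bd; [exact: leq_trans ab bd | exact: leq_trans bd ab].
- by move=> [a|a].
- by move=> [a|a].
Defined.

(** * Gluing morphisms over the cut and two copies of the segment *)

Section Relative.
Context (n i j : nat) (Hij : (i < j)%N) (Hjn : (j <= n)%N).
Local Notation c := (n - (j - i)).+1.
Local Notation K := (ordC (j - i)).
Local Notation L := (enC c).
Local Notation seg := (segM n i j).
Local Notation cut := (cutM n i j).
Local Notation e := (edgM (j - i) 0 (j - i)).
Local Notation e' := (edgM c i i.+1).

Definition segF : Mono K (enC n) := @Mono_ K (enC n) (fun k => (false, seg k)) (@mono _ _ seg).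
Definition segT : Mono (opC K) (enC n) :=
  @Mono_ (opC K) (enC n) (fun k => (true, seg k)) (fun a b => @mono _ _ seg b a).

Section RelGlue.
Context (C : Cat) (T : Functor C C) (d d' : NCobj T (enC n))
  (u : NChom (resD (ewM cut) d) (resD (ewM cut) d'))
  (uF : NChom (resD segF d) (resD segF d')) (uT : NChom (resD segT d) (resD segT d')).

Definition piece (o : option bool) : Chain :=
  match o with None => L | Some false => K | Some true => opC K end.
Definition pieceM (o : option bool) : Mono (piece o) (enC n) :=
  match o return Mono (piece o) (enC n) with
  | None => ewM cut | Some false => segF | Some true => segT end.
Definition pieceH (o : option bool) : NChom (resD (pieceM o) d) (resD (pieceM o) d') :=
  match o return NChom (resD (pieceM o) d) (resD (pieceM o) d') with
  | None => u | Some false => uF | Some true => uT end.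

Lemma rel_cover (p : 'I_n.+1) :
  (exists l, p = cut l) \/ (exists k, p = seg k).
Proof.
by case: (seg_cut_cover Hij Hjn p) => [[k <-]|[l <-]]; [right; exists k | left; exists l].
Qed.

(** The two copies of the segment are disjoint and each meets the cut only in the ends of an edge,
    so agreement there suffices. *)
Lemma rel_glue :
  (forall a s, cm u (false, e' a) ⊚ hx d (segF (e a)) (ewM cut (false, e' a)) s
             = hx d' (segF (e a)) (ewM cut (false, e' a)) s ⊚ cm uF (e a)) ->
  (forall a s, cm u (true, e' a) ⊚ hx d (segT (e a)) (ewM cut (true, e' a)) s
             = hx d' (segT (e a)) (ewM cut (true, e' a)) s ⊚ cm uT (e a)) ->
  exists w : NChom d d', [/\ forall l, cm w (ewM cut l) = cm u l,
    forall k, cm w (segF k) = cm uF k & forall k, cm w (segT k) = cm uT k].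
Proof.
move=> AF AT.
have cut_inj : injective (ewM cut).
  by move=> [b p] [b' q] /= [-> E]; congr pair; apply: (cutM_inj Hij Hjn); apply: val_inj; exact: E.
have [||||w wE] := @hom_glue C T (enC n) (option bool) piece pieceM _ _ _ d d' pieceH.
- move=> [b p]; case: (rel_cover p) => [[l ->]|[k ->]].
    by exists None, (b, l).
  by case: b; [exists (Some true), k | exists (Some false), k].
- move=> R R1 R2 R3; apply: en_steps => //.
  + apply: (seg_cut_steps Hij Hjn (R := fun a b => R (false, a) (false, b))).
    * by move=> k k' kk'; exact: (R3 (Some false)).
    * by move=> l l' ll'; apply: (R3 None (false, l) (false, l')); exact: ll'.
  + apply: (seg_cut_steps Hij Hjn (R := fun a b => R (true, b) (true, a))).
    * by move=> k k' kk'; exact: (R3 (Some true)).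
    * by move=> l l' ll'; apply: (R3 None (true, l') (true, l)); exact: ll'.
  (* The cut contains [n], hence the middle step. *)
  + move=> a an; have -> : a = cut ord_max.
      by rewrite (proj2 (cutM_ends Hij Hjn)); apply: val_inj.
    exact: (R3 None (false, ord_max) (true, ord_max)).
- exists None, (false, ord0), (true, ord0).
  by split; congr pair; exact: (proj1 (cutM_ends Hij Hjn)).
- have F k l s : segF k = ewM cut l ->
      cm u l ⊚ hx d (segF k) (ewM cut l) s = hx d' (segF k) (ewM cut l) s ⊚ cm uF k.
    case: l s => b p s H.
    have Eb : _ = b := congr1 fst H; have E : seg k = cut p := congr1 snd H; subst b.
    by have [a [Ek El]] := seg_cut_overlap Hij Hjn E; subst k p.
  have G k l s : segT k = ewM cut l ->
      cm u l ⊚ hx d (segT k) (ewM cut l) s = hx d' (segT k) (ewM cut l) s ⊚ cm uT k.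
    case: l s => b p s H.
    have Eb : _ = b := congr1 fst H; have E : seg k = cut p := congr1 snd H; subst b.
    by have [a [Ek El]] := seg_cut_overlap Hij Hjn E; subst k p.
  move=> [[]|] k [[]|] l s E.
  + have {}E : k = l by apply: (segM_inj Hij Hjn); exact: (congr1 snd E).
    by subst l; rewrite !hx_id comp1f compf1.
  + by [].
  + exact: G.
  + by [].
  + have {}E : k = l by apply: (segM_inj Hij Hjn); exact: (congr1 snd E).
    by subst l; rewrite !hx_id comp1f compf1.
  + exact: F.
  + have r : cle (segT l) (ewM cut k) by apply: cle_of_eq.
    exact: agree_sym (esym E) _ _ (sle_of r) s (G _ _ _ (esym E)).
  + have r : cle (segF l) (ewM cut k) by apply: cle_of_eq.
    exact: agree_sym (esym E) _ _ (sle_of r) s (F _ _ _ (esym E)).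
  + have {}E := cut_inj _ _ E.
    by subst l; rewrite !hx_id comp1f compf1.
- by exists w; split; [exact: (wE None) | exact: (wE (Some false)) | exact: (wE (Some true))].
Qed.
End RelGlue.
End Relative.

(** * Filling in the segment and its dual *)

Section RelativeObjects.
Context (C : Cat) (D : Duality C) (T : Functor C C)
        (lam : forall x : C, Hom (dP D x) (T (dP D (T x))))
        (Hnat : lam_nat lam) (Hcoh : lam_coh lam).
Context (n i j : nat) (Hij : (i < j)%N) (Hjn : (j <= n)%N).
Local Notation c := (n - (j - i)).+1.
Local Notation K := (ordC (j - i)).
Local Notation L := (enC c).
Local Notation seg := (segM n i j).
Local Notation cut := (cutM n i j).
Local Notation e := (edgM (j - i) 0 (j - i)).
Local Notation e' := (edgM c i i.+1).
Local Notation segF := (segF n i j).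
Local Notation segT := (segT n i j).

Definition mixSeg : Mono K (mixC n c) :=
  @Mono_ K (mixC n c) (fun k => inl (seg k)) (@mono _ _ seg).

Definition mixCut : Mono L (mixC n c).
Proof.
refine (@Mono_ L (mixC n c) (fun l => if l.1 then inr l.2 else inl (cut l.2)) _).
by move=> [[] p] [[] q] //=; rewrite /encle //=; exact: (@mono _ _ cut).
Defined.

Local Notation e1' := (compM (inclM c) e').

Lemma rel_le1 : cle (e1' ord0) (e1' ord_max).
Proof. exact: edge_le. Qed.
Lemma rel_lt1 : ~~ cle (e1' ord_max) (e1' ord0).
Proof. exact: edge_lt. Qed.

Definition mix_sec (a : mixC n c) : K + L :=
  match a with
  | inl p => match cut_sec i j p with inl k => inl k | inr l => inr (false, l) end
  | inr l => inr (true, l)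
  end.

Lemma mix_sec_cut l : mix_sec (mixCut l) = inr l.
Proof. by case: l => [[] p] //=; rewrite cut_sec_cut. Qed.

Lemma mix_sec_seg k : mix_sec (mixSeg k) = inl k \/
  exists a, k = e a /\ mix_sec (mixSeg k) = inr (e1' a).
Proof.
rewrite /=; case: (cut_sec_seg Hij Hjn k) => [->|[a [Ek ->]]]; first by left.
by right; exists a.
Qed.

Definition mix_secM : Mono (mixC n c) (insC K rel_le1 rel_lt1).
Proof.
refine (@Mono_ (mixC n c) (insC K rel_le1 rel_lt1) mix_sec _).
move=> [a|a] [b|b] //= ab.
  have := mono (cut_secM Hij Hjn) ab => /=.
  by case: (cut_sec i j a) => a'; case: (cut_sec i j b) => b'.
by case: (cut_sec i j a).
Defined.

Definition rev1M : Mono (ordC 1) (opC (ordC 1)).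
Proof.
refine (@Mono_ (ordC 1) (opC (ordC 1)) (@rev_ord 2) _).
by move=> a b ab; rewrite /= leq_sub2l.
Defined.

(** In [opC K] the edge starts at the last vertex of the segment, hence [rev_ord]. *)
Definition e2 : Mono (ordC 1) (opC K).
Proof.
refine (@Mono_ (ordC 1) (opC K) (fun a => e (rev_ord a)) _).
by move=> a b ab; apply: (mono e); rewrite /= leq_sub2l.
Defined.

Definition e2' : Mono (ordC 1) (mixC n c).
Proof.
refine (@Mono_ (ordC 1) (mixC n c) (fun a => inr (e' (rev_ord a))) _).
by move=> a b ab; apply: (mono e'); rewrite /= leq_sub2l.
Defined.

Definition enMix : Mono (mixC n c) (enC n).
Proof.
refine (@Mono_ (mixC n c) (enC n)
  (fun a => match a with inl p => (false, p) | inr l => (true, cut l) end) _).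
by move=> [a|a] [b|b] //= ab; exact: (@mono _ _ cut).
Defined.

Lemma e2_rev a : e2 (rev_ord a) = e a.
Proof. by change (e (rev_ord (rev_ord a)) = e a); rewrite rev_ordK. Qed.

Lemma e2'_rev a : e2' (rev_ord a) = inr (e' a).
Proof. by change (inr (e' (rev_ord (rev_ord a))) = inr (e' a) :> mixC n c); rewrite rev_ordK. Qed.

Lemma rel_bot2 k : cle (e2 ord0) k.
Proof. by have := ltn_ord k; rewrite /= /edgef; lia. Qed.
Lemma rel_top2 k : cle k (e2 ord_max).
Proof. by rewrite /= /edgef; lia. Qed.
Lemma rel_le2 : cle (e2' ord0) (e2' ord_max).
Proof. by rewrite /= /edgef; lia. Qed.
Lemma rel_lt2 : ~~ cle (e2' ord_max) (e2' ord0).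
Proof. by rewrite /= /edgef; lia. Qed.

Definition en_sec (a : enC n) : opC K + mixC n c :=
  if a.1 then match cut_sec i j a.2 with inl k => inl k | inr l => inr (inr l) end
  else inr (inl a.2).

Lemma en_sec_mix l : en_sec (enMix l) = inr l.
Proof. by case: l => p //=; rewrite /en_sec /= cut_sec_cut. Qed.

Lemma en_sec_seg k : en_sec (segT k) = inl k \/
  exists a, k = e2 a /\ en_sec (segT k) = inr (e2' a).
Proof.
rewrite /en_sec /=; case: (cut_sec_seg Hij Hjn k) => [->|[a [Ek ->]]]; first by left.
right; exists (rev_ord a); split; [rewrite Ek; exact: esym (e2_rev a) | congr inr; exact: esym (e2'_rev a)].
Qed.

Definition en_secM : Mono (enC n) (insC (opC K) rel_le2 rel_lt2).
Proof.
refine (@Mono_ (enC n) (insC (opC K) rel_le2 rel_lt2) en_sec _).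
move=> [[] a] [[] b] //= ab; rewrite /en_sec /=.
  have := mono (cut_secM Hij Hjn) ab => /=.
  case: (cut_sec i j a) => a'; case: (cut_sec i j b) => b' //=.
by case: (cut_sec i j b).
Defined.

Context (x : NCobj T K) (y : NUobj Hnat Hcoh c)
  (phi : NChom (resD e x) (resD e1' (ux y))).

(* The primed copy of the segment carries the dual diagram [P x], glued along the edge
   [j' < i'] of [y] by means of [P phi] and the form of [y]. *)
Lemma rel_diagram : exists (z : NCobj T (enC n)) (rF : NChom (resD segF z) x)
    (rT : NChom (resD segT z) (dualD lam x)) (tau : NChom (resD (ewM cut) z) (ux y)),
  (forall a s, cm tau (false, e' a) ⊚ hx z (segF (e a)) (ewM cut (false, e' a)) s
     = cm phi a ⊚ cm rF (e a)) /\
  (forall a s, Pm D (cm phi a) ⊚ cm (upsi y) (true, e' a) ⊚ cm tau (true, e' a)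
       ⊚ hx z (segT (e a)) (ewM cut (true, e' a)) s
     = cm rT (e a)).
Proof.
have [|||z1 [r1 [t1 E1]]] := @insertion_glue C T (mixC n c) K L e e1' (edge_bot Hij Hjn)
  (edge_top Hij Hjn) rel_le1 rel_lt1 mixSeg mixCut mix_secM _ _ _ x (ux y) phi.
- move=> a; congr inl; exact: (seg_cut_eq Hij Hjn a).
- exact: mix_sec_cut.
- exact: mix_sec_seg.
(* On the edge [j' < i'] the form of [y] followed by [P(phi)] leads to the dual of the edge of
   [x]. *)
pose chi a : Hom (vx (resD e2' z1) a) (vx (resD e2 (dualD lam x)) a) :=
  Pm D (cm phi (rev_ord a)) ⊚ (cm (upsi y) (true, e' (rev_ord a)) ⊚ cm t1 (true, e' (rev_ord a))).
have [chiH chiE] : exists h : NChom (resD e2' z1) (resD e2 (dualD lam x)), forall a, cm h a = chi a.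
  pose e3 : Mono (ordC 1) (enC c) :=
    @Mono_ (ordC 1) (enC c) (fun a => (true, e' (rev_ord a))) (@mono _ _ e2').
  pose h1 : NChom (resD e2' z1) (resD e3 (ux y)) := resH e3 t1.
  pose h2 : NChom (resD e3 (ux y)) (resD e3 (PeD lam (ux y))) := resH e3 (upsi y).
  pose h3 : NChom (resD e3 (PeD lam (ux y))) (resD e2 (dualD lam x)) := resH rev1M (dualH Hnat phi).
  by exists (NCcomp h3 (NCcomp h2 h1)).
have [chi' [X1 X2]] := NChom_inv chiH.
have [|||z [r2 [t2 E2]]] := @insertion_glue C T (enC n) (opC K) (mixC n c) e2 e2' rel_bot2 rel_top2
  rel_le2 rel_lt2 segT enMix en_secM _ _ _ (dualO Hnat x) z1 chi'.
- move=> a; congr pair; exact: (seg_cut_eq Hij Hjn (rev_ord a)).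
- exact: en_sec_mix.
- exact: en_sec_seg.
have Hc (l : enC c) : ewM cut l = compM enMix mixCut l by case: l => [[] p].
pose rF : NChom (resD segF z) x := NCcomp r1 (resH mixSeg t2).
(* [ewM cut] factors through the intermediate chain only pointwise, hence the reindexing. *)
pose tau : NChom (resD (ewM cut) z) (ux y) := NCcomp t1 (NCcomp (resH mixCut t2) (reidx z Hc)).
have tauE b p : cm tau (b, p) = cm t1 (b, p) ⊚ (cm t2 (mixCut (b, p)) ⊚
   hx z (ewM cut (b, p)) (enMix (mixCut (b, p))) (sle_of (cle_of_eq (Hc (b, p))))) by [].
exists z, rF, r2, tau; split=> a s.
- have := E1 a => {}E1.
  have r : cle (mixSeg (e a)) (mixCut (e1' a)) by exact: of_sle s.
  have N : cm t2 (mixCut (e1' a)) ⊚ hx z (enMix (mixSeg (e a))) (enMix (mixCut (e1' a))) s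
      = hx z1 _ _ (sle_of r) ⊚ cm t2 (mixSeg (e a)) := cm_h t2 _ _ (sle_of r).
  rewrite tauE -!compA hx_comp [hx _ _ _ _](_ : _ = hx z (enMix (mixSeg (e a))) (enMix (mixCut (e1' a))) s) //.
  rewrite N compA E1.
  by rewrite -compA.
- have [b Eb] : exists b, a = rev_ord b by exists (rev_ord a); rewrite rev_ordK.
  subst a.
  have r : cle (segT (e2 b)) (enMix (e2' b)) by exact: of_sle s.
  have E : cm t2 (e2' b) ⊚ hx z (segT (e2 b)) (enMix (e2' b)) s = cm chi' b ⊚ cm r2 (e2 b) := E2 b s.
  have Eh : cm r2 (e2 b) = chi b ⊚ cm t2 (e2' b) ⊚ hx z (segT (e2 b)) (enMix (e2' b)) s.
    by rewrite -compA E compA -chiE X2 comp1f.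
  change (Pm D (cm phi (rev_ord b)) ⊚ cm (upsi y) (true, e' (rev_ord b)) ⊚ cm tau (true, e' (rev_ord b))
       ⊚ hx z (segT (e2 b)) (enMix (e2' b)) s = cm r2 (e2 b)).
  rewrite Eh /chi tauE -!compA hx_comp.
  by [].
Qed.
End RelativeObjects.

(** * Symmetric forms and isometries in the relative case *)

Section RelativeSegal.
Context (C : Cat) (D : Duality C) (T : Functor C C)
        (lam : forall x : C, Hom (dP D x) (T (dP D (T x))))
        (Hnat : lam_nat lam) (Hcoh : lam_coh lam).
Context (n i j : nat) (Hij : (i < j)%N) (Hjn : (j <= n)%N).
Local Notation c := (n - (j - i)).+1.
Local Notation K := (ordC (j - i)).
Local Notation L := (enC c).
Local Notation seg := (segM n i j).
Local Notation cut := (cutM n i j).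
Local Notation e := (edgM (j - i) 0 (j - i)).
Local Notation e' := (edgM c i i.+1).
Local Notation segF := (segF n i j).
Local Notation segT := (segT n i j).

(** The form is pulled back from [y] on the cut. On the primed segment, which carries [P x], it is
    [P(rF) rT], the identity of [P x] seen through the comparisons; on the unprimed one symmetry
    forces [P(rT) Theta rF]. *)
Lemma rel_ess (x : NCobj T K) (y : NUobj Hnat Hcoh c)
    (phi : NChom (resD e x) (resD (compM (inclM c) e') (ux y))) :
  exists (z : NUobj Hnat Hcoh n) (rF : NChom (resD segF (ux z)) x) (tau : NUghom (resU cut z) y),
  forall a s, cm (uphi tau) (false, e' a) ⊚ hx (ux z) (segF (e a)) (ewM cut (false, e' a)) s
     = cm phi a ⊚ cm rF (e a).
Proof.
have [z [rF [rT [tau [EF ET]]]]] := rel_diagram Hij Hjn phi.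
pose u : NChom (resD (ewM cut) z) (resD (ewM cut) (PeD lam z)) :=
  NCcomp (PeH Hnat tau) (NCcomp (upsi y) tau).
pose uT : NChom (resD segT z) (resD segT (PeD lam z)) := NCcomp (dualH Hnat rF) rT.
have [uF uFE] : exists uF : NChom (resD segF z) (resD segF (PeD lam z)),
    forall k, cm uF k = Pm D (cm rT k) ⊚ (dTh D (vx x k) ⊚ cm rF k).
  pose h := NCcomp (ThetaD Hnat Hcoh x) rF.
  pose g := dualH Hnat rT.
  pose g' : NChom (ddual lam x) (resD segF (PeD lam z)) :=
    @NChom_ C T K (ddual lam x) (resD segF (PeD lam z)) (cm g) (cm_iso g) (cm_h g) (cm_k g).
  by exists (NCcomp g' h).
have eqp (a : ordC 1) b : (b, seg (e a)) = (b, cut (e' a)) :> enC n.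
  by congr pair; exact: (seg_cut_eq Hij Hjn a).
have [||psi [psiu psiF psiT]] := rel_glue Hij Hjn (d := z) (d' := PeO Hnat z) (u := u) (uF := uF) (uT := uT).
- move=> a s; rewrite uFE.
  change (Pm D (cm tau (true, e' a)) ⊚ (cm (upsi y) (false, e' a) ⊚ cm tau (false, e' a))
      ⊚ hx z (segF (e a)) (ewM cut (false, e' a)) s
    = Pm D (hx z (ewM cut (true, e' a)) (segT (e a)) (srev s))
      ⊚ (Pm D (cm rT (e a)) ⊚ (dTh D (vx x (e a)) ⊚ cm rF (e a)))).
  have r : cle (segT (e a)) (ewM cut (true, e' a)) by apply: cle_of_eq; exact: eqp.
  have ER : cm rT (e a) ⊚ hx z (ewM cut (true, e' a)) (segT (e a)) (srev s)
      = Pm D (cm phi a) ⊚ cm (upsi y) (true, e' a) ⊚ cm tau (true, e' a).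
    by rewrite -(ET a (sle_of r)) comp_hx_comp hx_id compf1.
  (* Once the gluing relations are substituted, what remains is the symmetry of the form of [y]. *)
  rewrite -!compA EF [RHS]compA -Pm_comp ER !Pm_comp -!compA (compA (Pm D (Pm D _))) Pm_Pm_Th.
  congr (_ ⊚ _); rewrite -!compA (compA (Pm D (cm (upsi y) (true, e' a)))).
  congr (_ ⊚ _); symmetry; exact: usymF.
- move=> a s.
  change (Pm D (cm tau (false, e' a)) ⊚ (cm (upsi y) (true, e' a) ⊚ cm tau (true, e' a))
      ⊚ hx z (segT (e a)) (ewM cut (true, e' a)) s
    = Pm D (hx z (ewM cut (false, e' a)) (segF (e a)) (srev s))
      ⊚ (Pm D (cm rF (e a)) ⊚ cm rT (e a))).
  have [phi' [P1 P2]] := NChom_inv phi.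
  have r : cle (segF (e a)) (ewM cut (false, e' a)) by apply: cle_of_eq; exact: eqp.
  have ER : cm rF (e a) ⊚ hx z (ewM cut (false, e' a)) (segF (e a)) (srev s)
      = cm phi' a ⊚ cm tau (false, e' a).
    exact: swap_glued (P1 a) (EF a (sle_of r)).
  rewrite [RHS]compA -Pm_comp ER -(ET a s) Pm_comp -!compA.
  congr (_ ⊚ _); rewrite (compA (Pm D (cm phi' a))) -Pm_comp P2 Pm_id comp1f.
  by [].
have psi_sym k : Pm D (cm psi (true, k)) ⊚ dTh D (vx z (false, k)) = cm psi (false, k).
  have [[l ->]|[l ->]] := rel_cover Hij Hjn k.
  - exact: (@pulled_form_sym C D T lam Hnat Hcoh n c cut z psi y tau psiu).
  - have HT : cm psi (true, seg l) = Pm D (cm rF l) ⊚ cm rT l := psiT l.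
    have HF : cm psi (false, seg l) = _ := psiF l.
    rewrite HT HF uFE Pm_comp -!compA Pm_Pm_Th.
    by [].
have [tau' Et] := @pulled_form_isometry C D T lam Hnat Hcoh n c cut z psi y tau psiu psi_sym.
by exists (form_obj Hnat Hcoh psi_sym), rF, tau' => a s; rewrite Et; exact: EF.
Qed.

(** On the primed segment the isometry equation [P(uF) psi_z uT = psi_y] can be solved for [uT],
    since [v1], that is [P(uF) psi_z], is invertible. *)
Lemma rel_full (y z : NUobj Hnat Hcoh n) (u : NUghom (resU cut y) (resU cut z))
    (uF : NChom (resD segF (ux y)) (resD segF (ux z))) :
  (forall a s, cm (uphi u) (false, e' a) ⊚ hx (ux y) (segF (e a)) (ewM cut (false, e' a)) s
             = hx (ux z) (segF (e a)) (ewM cut (false, e' a)) s ⊚ cm uF (e a)) ->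
  exists w : NUghom y z, (forall l, cm (uphi w) (ewM cut l) = cm (uphi u) l) /\
    (forall k, cm (uphi w) (segF k) = cm uF k).
Proof.
move=> AF.
have eqp (a : ordC 1) b : (b, seg (e a)) = (b, cut (e' a)) :> enC n.
  by congr pair; exact: (seg_cut_eq Hij Hjn a).
pose v1 : NChom (resD segT (ux z)) (dualD lam (resD segF (ux y))) :=
  NCcomp (dualH Hnat uF) (resH segT (upsi z)).
pose v2 : NChom (resD segT (ux y)) (dualD lam (resD segF (ux y))) := resH segT (upsi y).
have [v1' [V1 V2]] := NChom_inv v1.
pose uT : NChom (resD segT (ux y)) (resD segT (ux z)) := NCcomp v1' v2.
have uTE k : Pm D (cm uF k) ⊚ cm (upsi z) (segT k) ⊚ cm uT k = cm (upsi y) (segT k).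
  change (cm v1 k ⊚ (cm v1' k ⊚ cm v2 k) = cm v2 k).
  by rewrite compA V2 comp1f.
have [||w [wu wF wT]] := rel_glue Hij Hjn (d := ux y) (d' := ux z) (u := uphi u) (uF := uF) (uT := uT).
- exact: AF.
- move=> a s.
  have r : cle (ewM cut (true, e' a)) (segT (e a)) by apply: cle_of_eq; exact: esym (eqp a true).
  (* After cancelling [hx] and [v1], naturality of both forms and the dual of [AF] reduce the claim
     to the isometry equation of [u] at the primed end. *)
  apply: (iso_monic (hx_iso (ux z) (sle_of r) (of_sle s))).
  rewrite [RHS]compA hx_comp hx_id comp1f.
  apply: (iso_monic (cm_iso v1 (e a))).
  have -> : cm v1 (e a) ⊚ cm uT (e a) = cm (upsi y) (segT (e a)) := uTE (e a).
  change (Pm D (cm uF (e a)) ⊚ cm (upsi z) (segT (e a)) ⊚ (hx (ux z) (ewM cut (true, e' a)) (segT (e a)) (sle_of r)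
     ⊚ (cm (uphi u) (true, e' a) ⊚ hx (ux y) (segT (e a)) (ewM cut (true, e' a)) s)) = cm (upsi y) (segT (e a))).
  have N1 : cm (upsi z) (segT (e a)) ⊚ hx (ux z) (ewM cut (true, e' a)) (segT (e a)) (sle_of r)
     = Pm D (hx (ux z) (segF (e a)) (ewM cut (false, e' a)) (srev (sle_of r))) ⊚ cm (upsi z) (ewM cut (true, e' a)).
    exact: (cm_h (upsi z)).
  have N2 : cm (upsi y) (segT (e a)) ⊚ hx (ux y) (ewM cut (true, e' a)) (segT (e a)) (sle_of r)
     = Pm D (hx (ux y) (segF (e a)) (ewM cut (false, e' a)) (srev (sle_of r))) ⊚ cm (upsi y) (ewM cut (true, e' a)).
    exact: (cm_h (upsi y)).
  have U : Pm D (cm (uphi u) (false, e' a)) ⊚ cm (upsi z) (ewM cut (true, e' a)) ⊚ cm (uphi u) (true, e' a)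
     = cm (upsi y) (ewM cut (true, e' a)) := uiso u (true, e' a).
  rewrite -!compA (compA (cm (upsi z) (segT (e a)))) N1 !compA -Pm_comp -AF Pm_comp.
  rewrite -(compA (Pm D (hx (ux y) _ _ _))) -(compA _ _ (cm (uphi u) _)) U -N2 -compA hx_comp hx_id compf1.
  by [].
have [|g Eg] := @isometry_primed C D T lam Hnat Hcoh n y z w.
  move=> k; have [[l ->]|[l ->]] := rel_cover Hij Hjn k.
  - have HT : cm w (true, cut l) = cm (uphi u) (true, l) := wu (true, l).
    have HF : cm w (false, cut l) = cm (uphi u) (false, l) := wu (false, l).
    rewrite HT HF; exact: (uiso u (true, l)).
  - have HT : cm w (true, seg l) = cm uT l := wT l.
    have HF : cm w (false, seg l) = cm uF l := wF l.
    rewrite HT HF; exact: uTE.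
by exists g; rewrite Eg.
Qed.
End RelativeSegal.

Lemma F_rel2Segal_holds (C : Cat) (D : Duality C) (T : Functor C C)
        (lam : forall x : C, Hom (dP D x) (T (dP D (T x))))
        (Hnat : lam_nat lam) (Hcoh : lam_coh lam) : F_rel2Segal Hnat Hcoh.
Proof.
move=> n i j H2 Hij Hjn; split.
- move=> d d'; apply: inj_surj_bij.
  + move=> u v /= E; apply: NUhom_eq; apply: hom_eq => -[b p].
    have Ecut l : cm (uphi u) (ewM (cutM n i j) l) = cm (uphi v) (ewM (cutM n i j) l).
      exact: (congr1 (fun w => cm (uphi (w : NUghom _ _)) l) (congr1 (fun w => qb w) E)).
    have Eseg k : cm (uphi u) (false, segM n i j k) = cm (uphi v) (false, segM n i j k).
      exact: (congr1 (fun w => cm (w : NChom _ _) k) (congr1 (fun w => qa w) E)).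
    have [[l ->]|[k ->]] := rel_cover Hij Hjn p; first exact: (Ecut (b, l)).
    case: b; last exact: Eseg.
    (* A primed component on the segment is determined by the unprimed one through the isometry
       equation. *)
    have Uu : Pm D (cm (uphi u) (false, segM n i j k)) ⊚ cm (upsi d') (true, segM n i j k) ⊚ cm (uphi u) (true, segM n i j k)
      = cm (upsi d) (true, segM n i j k) := uiso u (true, _).
    have Uv : Pm D (cm (uphi v) (false, segM n i j k)) ⊚ cm (upsi d') (true, segM n i j k) ⊚ cm (uphi v) (true, segM n i j k)
      = cm (upsi d) (true, segM n i j k) := uiso v (true, _).
    rewrite -Uu Eseg in Uv; apply: iso_monic (esym Uv).
    by apply: iso_comp; [apply: Pm_iso; exact: (cm_iso (uphi v) (false, segM n i j k)) | exact: (cm_iso (upsi d') (true, segM n i j k))].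
  + move=> [u v cmm].
    have [|w [wu wF]] := @rel_full C D T lam Hnat Hcoh n i j Hij Hjn d d' v u.
      move=> a s; exact: (congr1 (fun w => cm (w : NChom _ _) a) cmm).
    by exists w; apply: PBhom_eq; [|apply: NUhom_eq]; apply: hom_eq.
- move=> [x y phi].
  have [z [rF [tau E]]] := @rel_ess C D T lam Hnat Hcoh n i j Hij Hjn x y phi.
  exists z; refine (inhabits (@PBhom_ _ _ _ _ _ (R2Sfun Hnat Hcoh Hij Hjn z) (PBobj_ phi) rF tau _)).
  by apply: hom_eq => a; exact: E.
Qed.

(** * Unitality *)

(** A linking square whose left side is the identity at [a]. *)
Lemma linked_hx (C : Cat) (T : Functor C C) (J : Chain) (z : NCobj T J) (a b : J)
  (w : Hom (vx z a) (vx z b)) (s : sle (cle a b)) : linked w -> w = hx z a b s.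
Proof.
move=> lw; have [_ l1] : linked (hx z a a (srefl a)) /\ linked (hx z a a (srefl a)).
  by split; apply: linked_le; apply: hx_iso; exact: cle_refl.
have := linked_square (srefl a) s l1 lw.
by rewrite !hx_id !compf1.
Qed.

Lemma hx_linked (C : Cat) (T : Functor C C) (J : Chain) (z : NCobj T J) (a b : J)
  (w : Hom (vx z a) (vx z b)) (s : sle (cle b a)) : linked w -> hx z b a s ⊚ w = idm _.
Proof.
move=> lw; have l1 : linked (hx z a a (srefl a)).
  by apply: linked_le; apply: hx_iso; exact: cle_refl.
have := linked_square (srefl a) s lw l1.
by rewrite !hx_id !compf1 => <-.
Qed.

Lemma enC_total (n : nat) (a b : enC n) : cle a b \/ cle b a.
Proof.
case: a b => [[] a] [[] b]; rewrite /= /encle /=; try by [left | right].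
  by case/orP: (leq_total a b); [right | left].
by apply/orP; exact: leq_total.
Qed.

Section Unital.
Context (C : Cat) (D : Duality C) (T : Functor C C)
        (lam : forall x : C, Hom (dP D x) (T (dP D (T x))))
        (Hnat : lam_nat lam) (Hcoh : lam_coh lam).
Context (n i : nat) (Hn : (2 <= n)%N) (Hi : (i <= n.-1)%N).
Local Notation deg := (degM n i).
Local Notation edg := (edgM n i i.+1).
Local Notation pt := (ptM n.-1 i).

Lemma cof_homo : {homo (fun p => if (p <= i)%N then p else p.+1) : p q / (p <= q)%N}.
Proof. by move=> p q pq; case: ifP => h1; case: ifP => h2; lia. Qed.

(* omits [i + 1] *)
Definition cofM : Mono (ordC n.-1) (ordC n) := clampM n.-1 n cof_homo.

Lemma deg_cof a : compM deg cofM a = a.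
Proof.
have an := ltn_ord a; apply: val_inj; rewrite /= /degf.
by case: (leqP a i) => h1; case: ifP => h2; lia.
Qed.

Lemma cof_deg p : cofM (deg p) = if p == i.+1 :> nat then Ordinal (clamp_lt i n) else p.
Proof.
have pn := ltn_ord p; apply: val_inj; rewrite (fun_if val) /= /degf.
by case: (leqP p i) => h1; case: ifP => h2; case: ifP => h3; lia.
Qed.

Lemma deg_faithful (y z : NUobj Hnat Hcoh n.-1) (u v : NUghom y z) :
  resUH deg u = resUH deg v -> u = v.
Proof.
move=> E; apply: NUhom_eq; apply: hom_eq => -[b p].
have Ep : (b, p) = ewM deg (ewM cofM (b, p)) by congr pair; exact: esym (deg_cof p).
rewrite Ep; exact: (congr1 (fun w => cm (uphi w) _) E).
Qed.

(** [deg] is split by [cofM], so [w] is [v] restricted along [cofM]. To recover [v] at [a], compare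
    [a] with [cofM (deg a)]: both have the same image under [deg], and [v] is natural along the
    arrow joining them. *)
Lemma deg_full (y z : NUobj Hnat Hcoh n.-1) (v : NUghom (resU deg y) (resU deg z)) :
  exists w : NUghom y z, resUH deg w = v.
Proof.
have [ry Ry] := @resU_id C D T lam Hnat Hcoh _ (compM deg cofM) y deg_cof.
have [rz Rz] := @resU_id C D T lam Hnat Hcoh _ (compM deg cofM) z deg_cof.
have [sy [S1 S2]] := isometry_inv ry.
pose w : NUghom y z := NUcomp rz (NUcomp (resUH cofM v) sy).
exists w; apply: NUhom_eq; apply: hom_eq => a.
set a' := ewM cofM (ewM deg a).
have Ea : ewM deg a' = ewM deg a by case: a @a' => b p; congr pair; exact: deg_cof (deg p).
have r := cle_of_eq Ea; have r' := cle_of_eq (esym Ea).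
change (cm (uphi rz) (ewM deg a) ⊚ (cm (uphi v) a' ⊚ cm (uphi sy) (ewM deg a)) = cm (uphi v) a).
rewrite (Rz _ (sle_of r)).
have A : cm (uphi v) a ⊚ hx (ux y) (ewM deg a') (ewM deg a) (sle_of r)
    = hx (ux z) (ewM deg a') (ewM deg a) (sle_of r) ⊚ cm (uphi v) a'.
  case: (enC_total a' a) => h.
    exact: (cm_h (uphi v) a' a (sle_of h)).
  exact: agree_sym (esym Ea) _ _ (sle_of r') (sle_of r) (cm_h (uphi v) a a' (sle_of h)).
have S2' : hx (ux y) (ewM deg a') (ewM deg a) (sle_of r) ⊚ cm (uphi sy) (ewM deg a) = idm _.
  by rewrite -[RHS](S2 (ewM deg a)) (Ry _ (sle_of r)).
rewrite compA.
change (hx (ux z) (ewM deg a') (ewM deg a) (sle_of r) ⊚ cm (uphi v) a' ⊚ cm (uphi sy) (ewM deg a) = cm (uphi v) a).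
by rewrite -A -compA S2' compf1.
Qed.

(** When the edge at [i] is invertible, each vertex is linked to its image under [cofM] after [deg],
    and the linked arrows form an isometry. *)
Lemma deg_ess (y : NUobj Hnat Hcoh n) (s : sle (cle (inclM n (edg ord0)) (inclM n (edg ord_max)))) :
  is_iso (hx (ux y) (inclM n (edg ord0)) (inclM n (edg ord_max)) s) ->
  exists w : NUghom (resU deg (resU cofM y)) y,
    forall p r, cm (uphi w) (false, p) = hx (ux y) (false, cofM (deg p)) (false, p) r.
Proof.
move=> hi.
pose q0 : 'I_n.+1 := edg ord0; pose q1 : 'I_n.+1 := edg ord_max.
have E0 : Ordinal (clamp_lt i n) = q0 by apply: val_inj; rewrite /= /edgef; lia.
have E1 (p : 'I_n.+1) : p = i.+1 :> nat -> p = q1.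
  by move=> Ep; have pn := ltn_ord p; apply: val_inj; rewrite /= /edgef; lia.
pose vF (q : 'I_n.+1) : enC n := (false, q); pose vT (q : 'I_n.+1) : enC n := (true, q).
have s' : cle (vT q1) (vT q0) by exact: (of_sle s).
(* Through the form, the edge [(i+1)' -> i'] is the [P]-dual of the edge [i -> i+1]. *)
have hi' : is_iso (hx (ux y) (vT q1) (vT q0) (sle_of s')).
  have N : cm (upsi y) (vT q0) ⊚ hx (ux y) (vT q1) (vT q0) (sle_of s')
     = Pm D (hx (ux y) (vF q0) (vF q1) (srev (sle_of s'))) ⊚ cm (upsi y) (vT q1).
    exact: (cm_h (upsi y)).
  have [g [gi [G1 G2]]] := iso_inv (cm_iso (upsi y) (vT q0)).
  have -> : hx (ux y) (vT q1) (vT q0) (sle_of s') = g ⊚ (cm (upsi y) (vT q0) ⊚ hx (ux y) (vT q1) (vT q0) (sle_of s')).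
    by rewrite compA G1 comp1f.
  rewrite N; apply: iso_comp => //.
  by apply: iso_comp; [apply: Pm_iso; exact: hi | exact: (cm_iso (upsi y))].
have [|w lw] := @linked_NChom C T (enC n) (ux y) (enC n) (ewM (compM cofM deg))
    (@Mono_ (enC n) (enC n) id (fun _ _ h => h)).
  move=> [b p]; have := cof_deg p.
  case: eqP => [Ep H|_ H]; last by apply: linked_eq; congr pair; exact: H.
  have Hp := E1 _ Ep; subst p; rewrite E0 in H.
  have -> : ewM (compM cofM deg) (b, q1) = (b, q0) by congr pair; exact: H.
  case: b; last by exists (hx (ux y) (vF q0) (vF q1) s); exact: linked_le.
  (* On the primed side the comparison goes from [i'] to [(i+1)'], against the order, so the inverse
     is taken. *)
  have [g [gi [G1 G2]]] := iso_inv hi'.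
  exists g; apply: (@linked_inv _ _ _ (ux y) (vT q1) (vT q0) _ g G1 G2).
  exact: linked_le.
have cd_le (p : 'I_n.+1) : cle (vF (cofM (deg p))) (vF p).
  change (nat_of_ord (cofM (deg p)) <= p)%N; rewrite cof_deg.
  by case: eqP => //= ->; lia.
have wF p r : cm w (vF p) = hx (ux y) (vF (cofM (deg p))) (vF p) r by exact: linked_hx (lw (vF p)).
have [|g Eg] := @isometry_unprimed C D T lam Hnat Hcoh n (resU deg (resU cofM y)) y
    (@NChom_ C T (enC n) (ux (resU deg (resU cofM y))) (ux y) (cm w) (cm_iso w) (cm_h w) (cm_k w)).
  move=> k.
  have N : cm (upsi y) (vF k) ⊚ hx (ux y) (vF (cofM (deg k))) (vF k) (sle_of (cd_le k))
    = Pm D (hx (ux y) (vT k) (vT (cofM (deg k))) (srev (sle_of (cd_le k)))) ⊚ cm (upsi y) (vF (cofM (deg k))).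
    exact: (cm_h (upsi y)).
  have W : hx (ux y) (vT k) (vT (cofM (deg k))) (srev (sle_of (cd_le k))) ⊚ cm w (vT k) = idm _.
    exact: hx_linked (lw (vT k)).
  change (Pm D (cm w (vT k)) ⊚ cm (upsi y) (vF k) ⊚ cm w (vF k) = cm (upsi y) (vF (cofM (deg k)))).
  by rewrite (wF k (sle_of (cd_le k))) -compA N compA -Pm_comp W Pm_id comp1f.
by exists g => p r; rewrite Eg; exact: wF.
Qed.
End Unital.

Lemma F_unital_holds (C : Cat) (D : Duality C) (T : Functor C C)
        (lam : forall x : C, Hom (dP D x) (T (dP D (T x))))
        (Hnat : lam_nat lam) (Hcoh : lam_coh lam) : F_unital Hnat Hcoh.
Proof.
move=> n i Hn Hi; split.
- move=> d d'; apply: inj_surj_bij.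
  + move=> u v /= E; apply: (deg_faithful (n := n) (i := i)) => //.
    exact: (congr1 (fun w => qb w) E).
  + move=> [u v cmm].
    have [w Ew] := deg_full (n := n) (i := i) Hn Hi v.
    exists w; apply: PBhom_eq => //; apply: hom_eq => a.
    (* The component at the single vertex of [[0]] is forced by the compatibility square at the
       source of the edge. *)
    have -> : a = clampM 1 0 (ptf_homo 0) ord0 by rewrite (ord1 a); apply: val_inj.
    pose p := inclM n (edgM n i i.+1 ord0); pose q := ewM (ptM n.-1 i) (inclM 0 (clampM 1 0 (ptf_homo 0) ord0)).
    have s : cle q (ewM (degM n i) p) by apply: cle_of_eq; exact: (pt_deg_eq Hn Hi ord0).
    have s' : cle (ewM (degM n i) p) q by apply: cle_of_eq; exact: esym (pt_deg_eq Hn Hi ord0).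
    have A : cm (uphi v) p ⊚ hx (ux d) q (ewM (degM n i) p) (sle_of s)
      = hx (ux d') q (ewM (degM n i) p) (sle_of s) ⊚ cm u (clampM 1 0 (ptf_homo 0) ord0).
      exact: (congr1 (fun w => cm (w : NChom _ _) (ord0 : ordC 1)) cmm).
    have Ep : cm (uphi v) p = cm (uphi w) (ewM (degM n i) p) by rewrite -Ew.
    apply: (iso_monic (hx_iso (ux d') (sle_of s) s')).
    rewrite -A Ep; symmetry; exact: (cm_h (uphi w) q (ewM (degM n i) p) (sle_of s)).
- move=> [x y phi].
  have x01 : cle (clampM 1 0 (ptf_homo 0) ord0) (clampM 1 0 (ptf_homo 0) ord_max) by [].
  have o01 : cle (ord0 : ordC 1) ord_max by [].
  have [phi' [P1 P2]] := NChom_inv phi.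
  have Nphi c (r : sle (cle (ord0 : ordC 1) c)) := cm_h phi ord0 c r.
  (* [phi] conjugates this edge of [y] to an edge of a degenerate diagram, which is invertible. *)
  have hi : is_iso (hx (ux y) (inclM n (edgM n i i.+1 ord0)) (inclM n (edgM n i i.+1 ord_max))
      (smono (inclM n) (smono (edgM n i i.+1) (sle_of o01)))).
    have -> : hx (ux y) (inclM n (edgM n i i.+1 ord0)) (inclM n (edgM n i i.+1 ord_max))
      (smono (inclM n) (smono (edgM n i i.+1) (sle_of o01))) = cm phi ord_max ⊚ hx x _ _ (sle_of x01) ⊚ cm phi' ord0.
      have N := Nphi ord_max (sle_of o01); cbn -[sle] in N |- *.
      by rewrite N -compA [X in _ ⊚ X](P2 ord0) compf1.
    apply: iso_comp; last exact: (cm_iso phi' (ord0 : ordC 1)).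
    by apply: iso_comp; [exact: (cm_iso phi) | exact: hx_iso].
  have [w Ew] := deg_ess Hn Hi hi.
  pose cl := clampM 1 0 (ptf_homo 0).
  pose p0 := inclM n (edgM n i i.+1 ord0).
  pose vq (a : ordC 0) := ewM (cofM Hn Hi) (ewM (ptM n.-1 i) (inclM 0 a)).
  have vqE a : vq a = p0.
    congr pair; apply: val_inj; have an := ltn_ord a; rewrite /= /ptf /edgef.
    by case: ifP => h; lia.
  (* [d0] picks the source of the edge; the point of [z] is then compared with [x] by reindexing to
     [y_i] and applying the inverse of [phi] there. *)
  pose d0 : Mono (ordC 0) (ordC 1) := @Mono_ (ordC 0) (ordC 1) (fun _ => ord0) (fun _ _ _ => erefl).
  pose z := resU (cofM Hn Hi) y.
  pose m1 := compM (ewM (cofM Hn Hi)) (compM (ewM (ptM n.-1 i)) (inclM 0)).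
  pose m2 := compM (inclM n) (compM (edgM n i i.+1) d0).
  pose r1 : NChom (resD m1 (ux y)) (resD m2 (ux y)) := reidx (ux y) (f := m1) (g := m2) vqE.
  pose r2 : NChom (resD m2 (ux y)) (resD (compM cl d0) x) := resH d0 phi'.
  have clE (a : ordC 0) : compM cl d0 a = @Mono_ (ordC 0) (ordC 0) id (fun _ _ h => h) a.
    by rewrite [RHS](ord1 a); apply: val_inj.
  pose r3 := reidx x clE.
  pose qa0 := NCcomp r3 (NCcomp r2 r1).
  pose qa : NChom (resD (inclM 0) (resD (ewM (ptM n.-1 i)) (ux z))) x :=
    @NChom_ C T (ordC 0) (resD (inclM 0) (resD (ewM (ptM n.-1 i)) (ux z))) x (cm qa0) (cm_iso qa0) (cm_h qa0) (cm_k qa0).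
  exists z; refine (inhabits (@PBhom_ _ _ _ _ _ (Ufun Hnat Hcoh Hn Hi z) (PBobj_ phi) qa w _)).
  apply: hom_eq => a.
  have r0 : cle (vq (cl a)) p0 by apply: cle_of_eq.
  have rx : cle (cl ord0) (cl a) by [].
  have ra : cle (ord0 : ordC 1) a by [].
  have rd : cle (inclM n (cofM Hn Hi (degM n i (edgM n i i.+1 a)))) (inclM n (edgM n i i.+1 a)).
    change (cofM Hn Hi (degM n i (edgM n i i.+1 a)) <= edgM n i i.+1 a)%N.
    by rewrite cof_deg; case: eqP => //= ->; lia.
  have rq : cle (vq (cl a)) (inclM n (cofM Hn Hi (degM n i (edgM n i i.+1 a)))).
    exact: (@mono _ _ (ewM (cofM Hn Hi)) _ _ (cle_of_eq (pt_deg_eq Hn Hi a))).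
  change (cm (uphi w) (inclM n (edgM n i i.+1 a)) ⊚ hx (ux y) (vq (cl a)) (inclM n (cofM Hn Hi (degM n i (edgM n i i.+1 a)))) (sle_of rq)
    = cm phi a ⊚ (hx x (cl ord0) (cl a) (sle_of rx) ⊚ (cm phi' (ord0 : ordC 1) ⊚ hx (ux y) (vq (cl a)) p0 (sle_of r0)))).
  rewrite (Ew _ (sle_of rd)) hx_comp.
  have N : cm phi a ⊚ hx x (cl ord0) (cl a) (sle_of rx)
    = hx (ux y) p0 (inclM n (edgM n i i.+1 a)) (smono (inclM n) (smono (edgM n i i.+1) (sle_of ra))) ⊚ cm phi (ord0 : ordC 1)
    := Nphi a (sle_of ra).
  rewrite compA N -!compA (compA (cm phi _)) P2 comp1f.
  by rewrite hx_comp.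
Qed.

Theorem mainTheorem13 (C : Cat) (D : Duality C) (T : Functor C C)
  (lam : forall x : C, Hom (dP D x) (T (dP D (T x))))
  (Hnat : lam_nat lam) (Hcoh : lam_coh lam) :
  NU_unital_rel2Segal Hnat Hcoh.
Proof.
split; first exact: NC_2Segal_holds.
split; first exact: NU_1Segal_holds.
split; [exact: F_rel2Segal_holds | exact: F_unital_holds].
Qed.
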